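(* Let $l=2n+1$ with $n\ge1$, and let $\mathcal{F}_l$, its elements $\psi_i,\gamma_i$ ($0\le i\le l-1$), the action of $\langle T_1,r_0,\ldots,r_{l-1}\rangle$ on $\mathcal{F}_l[[\epsilon]]$, the induced action of $r_0,\ldots,r_{l-1}$ on $\mathcal{F}_l$, and the $\mathbb{C}$-derivation $\partial\phi=\left.\frac{T_1(\phi)-\phi}{\epsilon}\right|_{\epsilon=0}$ of $\mathcal{F}_l$ be as in the context. Then: (1) For $i=0,\ldots,l-1$, $$\partial\psi_i=\psi_i\Big(\sum_{1\le r\le n}\psi_{i+2r-1}\Big)-\Big(\sum_{1\le r\le n}\psi_{i+2r}\Big)\psi_i+\gamma_i,$$ with indices of $\psi$ taken in $\mathbb{Z}/l\mathbb{Z}$. (2) The action of $r_0,\ldots,r_{l-1}$ on $\mathcal{F}_l$ commutes with the derivation $\partial$.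
   Context: Let $l=2n+1$, $n\ge1$. **The skew field $\mathcal{K}_l$ (specialized).** $\mathcal{K}_l$ is here the quotient skew field of the $\mathbb{C}$-algebra with generators $f_i,\alpha_i$ ($i\in\mathbb{Z}/(l+1)\mathbb{Z}$), $h$ and relations $[f_i,f_{i+1}]=h$, $[f_i,f_j]=0$ ($j\neq i\pm1$), $\alpha_i$ and $h$ central, together with the normalization $f_0+f_2+\cdots+f_{2n}=1$, $f_1+f_3+\cdots+f_{2n+1}=1$ (these sums are central and invariant). Automorphisms: $s_i(f_j)=f_j+\frac{\alpha_i}{f_i}u_{ij}$, $s_i(\alpha_j)=\alpha_j-\alpha_ia_{ij}$, $s_i(h)=h$, $\pi(f_j)=f_{j+1}$, $\pi(\alpha_j)=\alpha_{j+1}$, $\pi(h)=h$, where $a_{ii}=2$, $a_{i,i\pm1}=-1$, $a_{ij}=0$ otherwise, $u_{i,i\pm1}=\pm1$, $u_{ij}=0$ otherwise (indices mod $l+1$). Put $T_1=\pi s_ls_{l-1}\cdots s_1$ (composition), and $r_0=s_0s_1s_0$, $r_i=s_{i+1}$ for $1\le i\le l-1$; $\widetilde W'=\langle T_1,r_0,\ldots,r_{l-1}\rangle$. **The skew field $\mathcal{F}_l$.** It is the quotient skew field of the $\mathbb{C}$-algebra with generators $\varphi_i,\beta_i$ ($i\in\mathbb{Z}/(l+1)\mathbb{Z}$), $t,h'$ and relations $[\varphi_i,\varphi_{i+1}]=h'$, $[\varphi_i,\varphi_j]=0$ ($j\ne i\pm1$), $\beta_i,t,h'$ central, $\varphi_0+\varphi_2+\cdots+\varphi_{2n}=0$,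 $\varphi_1+\varphi_3+\cdots+\varphi_{2n+1}=0$, $\beta_0+\cdots+\beta_l=1$. $\mathcal{F}_l(\epsilon)$ is the quotient skew field of $\mathcal{F}_l[\epsilon]$ ($\epsilon$ central), and $\mathcal{F}_l[[\epsilon]]$ the formal power series ring; elements of $\mathcal{F}_l(\epsilon)$ are expanded as Laurent series in $\epsilon$. **The homomorphism** $\Psi:\mathcal{K}_l\to\mathcal{F}_l(\epsilon)$: $\Psi(f_0)=1+\epsilon\varphi_0$, $\Psi(f_1)=1+\epsilon\varphi_1$, $\Psi(f_i)=\epsilon\varphi_i$ ($2\le i\le l$), $\Psi(\alpha_0)=-1+\epsilon t+\epsilon^2\beta_0$, $\Psi(\alpha_1)=1-\epsilon t+\epsilon^2\beta_1$, $\Psi(\alpha_i)=\epsilon^2\beta_i$ ($2\le i\le l$), $\Psi(h)=\epsilon^2h'$. **Elements.** $\psi_0=\varphi_0+\varphi_1+t$, $\psi_i=\varphi_{i+1}$ ($1\le i\le l-1$), $\gamma_0=\beta_0+\beta_1$, $\gamma_i=\beta_{i+1}$ ($1\le i\le l-1$). **Action of $\widetilde W'$** on $\mathcal{F}_l[[\epsilon]]$ (by ring automorphisms fixing $\mathbb{C}$, $\epsilon$ and $h'$): $T_1(t)=t+\epsilon$, $T_1(\beta_i)=\beta_i$ ($0\le i\le l$), $T_1(\psi_i)=\Psi T_1(f_{i+1})/\epsilon$ ($1\le i\le l-1$); for $0\le i\le l-1$: $r_i(t)=t$, $r_i(\gamma_j)=\gamma_j-\gamma_ia'_{ij}$ ($0\le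 j\le l-1$), $r_i(\psi_j)=\Psi r_i(f_{j+1})/\epsilon$ ($1\le j\le l-1$), and $r_0(\beta_0)=-\beta_1$, $r_{l-1}(\beta_0)=\beta_0+\beta_l$, $r_i(\beta_0)=\beta_0$ ($1\le i\le l-2$), where $(a'_{ij})_{i,j=0}^{l-1}$ is the generalized Cartan matrix of type $A_{l-1}^{(1)}$ ($a'_{ii}=2$, $a'_{i,i\pm1}=-1$, $0$ otherwise, indices mod $l$). One has $T_1(\phi)-\phi\in\epsilon\mathcal{F}_l[[\epsilon]]$ for all $\phi\in\mathcal{F}_l[[\epsilon]]$, so $\partial$ is well defined; and each $r_i$ preserves $\epsilon\mathcal{F}_l[[\epsilon]]$, so $r_0,\ldots,r_{l-1}$ act on $\mathcal{F}_l=\mathcal{F}_l[[\epsilon]]/\epsilon\mathcal{F}_l[[\epsilon]]$. *)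

(* Defs.v *)
From HB Require Import structures.
From mathcomp Require Import all_boot all_order all_algebra.
From mathcomp Require Import boolp classical_sets functions cardinality fsbigop.
From mathcomp Require Import reals.
From mathcomp Require Import complex.
From mathcomp Require Import zify.
From mathcomp Require Import monalg.

Set Implicit Arguments.
Unset Strict Implicit.
Unset Printing Implicit Defensive.

Import Order.TTheory GRing.Theory Num.Theory.
Local Open Scope ring_scope.

(* The ideal may be improper, so the quotient is only a [pzRingType]. *)
Section QuotientRing.
Variables (A : nzRingType) (S : A -> Prop).

Inductive ideal_gen : A -> Prop :=
| ideal_gen_in x : S x -> ideal_gen x
| ideal_gen0 : ideal_gen 0
| ideal_genD x y : ideal_gen x -> ideal_gen y -> ideal_gen (x + y)
| ideal_genMl a x : ideal_gen x -> ideal_gen (a * x)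
| ideal_genMr a x : ideal_gen x -> ideal_gen (x * a).

Lemma ideal_genN x : ideal_gen x -> ideal_gen (- x).
Proof. by move=> Ix; rewrite -mulN1r; apply: ideal_genMl. Qed.

Definition ideal_eqv (x y : A) : bool := `[< ideal_gen (x - y) >].

Lemma ideal_eqv_refl : reflexive ideal_eqv.
Proof. by move=> x; apply/asboolP; rewrite subrr; apply: ideal_gen0. Qed.

Lemma ideal_eqv_sym : symmetric ideal_eqv.
Proof.
by move=> x y; apply/asboolP/asboolP => /ideal_genN; rewrite opprB.
Qed.

Lemma ideal_eqv_trans : transitive ideal_eqv.
Proof.
move=> y x z /asboolP xy /asboolP yz; apply/asboolP.
by rewrite -(subrKA y); apply: ideal_genD.
Qed.

Canonical ideal_equiv :=
  EquivRel ideal_eqv ideal_eqv_refl ideal_eqv_sym ideal_eqv_trans.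

Local Open Scope quotient_scope.

Definition quot_ring := {eq_quot ideal_equiv}.
HB.instance Definition _ := Choice.on quot_ring.
HB.instance Definition _ : EqQuotient A ideal_equiv quot_ring :=
  EqQuotient.on quot_ring.

Definition quot_pi : A -> quot_ring := \pi_quot_ring.

Lemma quot_piP x y : quot_pi x = quot_pi y <-> ideal_gen (x - y).
Proof.
split=> [/eqmodP /asboolP //|Ixy].
by apply/eqmodP/asboolP.
Qed.

Let rp (q : quot_ring) : A := repr q.

Let rpK q : quot_pi (rp q) = q. Proof. exact: reprK. Qed.

Let rp_pi x : ideal_gen (rp (quot_pi x) - x).
Proof. by apply/quot_piP; rewrite rpK. Qed.

Definition quot_add (p q : quot_ring) := quot_pi (rp p + rp q).
Definition quot_opp (p : quot_ring) := quot_pi (- rp p).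
Definition quot_mul (p q : quot_ring) := quot_pi (rp p * rp q).

Let piD x y : quot_add (quot_pi x) (quot_pi y) = quot_pi (x + y).
Proof.
apply/quot_piP; rewrite opprD addrACA.
by apply: ideal_genD; apply: rp_pi.
Qed.

Let piN x : quot_opp (quot_pi x) = quot_pi (- x).
Proof. by apply/quot_piP; rewrite -opprD; apply/ideal_genN/rp_pi. Qed.

Let piM x y : quot_mul (quot_pi x) (quot_pi y) = quot_pi (x * y).
Proof.
apply/quot_piP; rewrite -(subrKA (x * rp (quot_pi y))) -mulrBl -mulrBr.
apply: ideal_genD; first exact/ideal_genMr/rp_pi.
exact/ideal_genMl/rp_pi.
Qed.

Let pi_ind (P : quot_ring -> Prop) : (forall x, P (quot_pi x)) -> forall q, P q.
Proof. by move=> H q; rewrite -[q]rpK. Qed.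

Let addA : associative quot_add.
Proof.
elim/pi_ind=> x; elim/pi_ind=> y; elim/pi_ind=> z.
by rewrite !piD addrA.
Qed.
Let addC : commutative quot_add.
Proof. by elim/pi_ind=> x; elim/pi_ind=> y; rewrite !piD addrC. Qed.
Let add0 : left_id (quot_pi 0) quot_add.
Proof. by elim/pi_ind=> x; rewrite piD add0r. Qed.
Let addN : left_inverse (quot_pi 0) quot_opp quot_add.
Proof. by elim/pi_ind=> x; rewrite piN piD addNr. Qed.

HB.instance Definition _ :=
  GRing.isZmodule.Build quot_ring addA addC add0 addN.

Let mulA : associative quot_mul.
Proof.
elim/pi_ind=> x; elim/pi_ind=> y; elim/pi_ind=> z.
by rewrite !piM mulrA.
Qed.
Let mul1 : left_id (quot_pi 1) quot_mul.
Proof. by elim/pi_ind=> x; rewrite piM mul1r. Qed.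
Let mulq1 : right_id (quot_pi 1) quot_mul.
Proof. by elim/pi_ind=> x; rewrite piM mulr1. Qed.
Let mulDl : left_distributive quot_mul quot_add.
Proof.
elim/pi_ind=> x; elim/pi_ind=> y; elim/pi_ind=> z.
by rewrite !(piM, piD) mulrDl.
Qed.
Let mulDr : right_distributive quot_mul quot_add.
Proof.
elim/pi_ind=> x; elim/pi_ind=> y; elim/pi_ind=> z.
by rewrite !(piM, piD) mulrDr.
Qed.

HB.instance Definition _ :=
  GRing.Zmodule_isPzRing.Build quot_ring mulA mul1 mulq1 mulDl mulDr.

Let quot_pi_additive : {morph quot_pi : x y / x - y}.
Proof. by move=> x y; rewrite -piD -piN. Qed.

HB.instance Definition _ :=
  GRing.isZmodMorphism.Build A quot_ring quot_pi quot_pi_additive.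

Let quot_pi_monoid : monoid_morphism quot_pi.
Proof. by split=> // x y; rewrite -piM. Qed.

HB.instance Definition _ :=
  GRing.isMonoidMorphism.Build A quot_ring quot_pi quot_pi_monoid.

End QuotientRing.

Record fps (F : nzRingType) : Type := Fps { fps_coef : nat -> F }.

HB.instance Definition _ (F : nzRingType) := gen_eqMixin (fps F).
HB.instance Definition _ (F : nzRingType) := gen_choiceMixin (fps F).

Section PowerSeries.
Variable F : nzRingType.
Implicit Types p q r : fps F.

Lemma fpsP p q : fps_coef p =1 fps_coef q -> p = q.
Proof. by case: p q => [p] [q] /= /funext->. Qed.

Definition fps_add p q := Fps (fun k => fps_coef p k + fps_coef q k).
Definition fps_opp p := Fps (fun k => - fps_coef p k).
Definition fps_mul p q :=
  Fps (fun k => \sum_(i < k.+1) fps_coef p i * fps_coef q (k - i)).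

Definition fps_of_poly (P : {poly F}) : fps F := Fps (fun k => P`_k).

Definition fpsC (c : F) : fps F := fps_of_poly c%:P.

Definition fps_eps : fps F := fps_of_poly 'X.

Let addA : associative fps_add.
Proof. by move=> p q r; apply: fpsP => k /=; rewrite addrA. Qed.
Let addC : commutative fps_add.
Proof. by move=> p q; apply: fpsP => k /=; rewrite addrC. Qed.
Let add0 : left_id (fpsC 0) fps_add.
Proof. by move=> p; apply: fpsP => k /=; rewrite coef0 add0r. Qed.
Let addN : left_inverse (fpsC 0) fps_opp fps_add.
Proof. by move=> p; apply: fpsP => k /=; rewrite coef0 addNr. Qed.

HB.instance Definition _ := GRing.isZmodule.Build (fps F) addA addC add0 addN.

Let tr m p : {poly F} := \poly_(i < m) fps_coef p i.

Let tr_mul m p q k : (k < m)%N -> fps_coef (fps_mul p q) k = (tr m p * tr m q)`_k.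
Proof.
move=> km; rewrite coefM; apply: eq_bigr => i _; rewrite !coef_poly.
by rewrite !(leq_ltn_trans _ km) ?leq_subr // -ltnS.
Qed.

Let mulA : associative fps_mul.
Proof.
move=> p q r; apply: fpsP => k.
have Hl (P Q Q' : {poly F}) :
    (forall i, (i < k.+1)%N -> Q`_i = Q'`_i) -> (P * Q)`_k = (P * Q')`_k.
  by move=> QQ'; rewrite !coefM; apply: eq_bigr => i _; rewrite QQ' // ltnS leq_subr.
have Hr (P Q Q' : {poly F}) :
    (forall i, (i < k.+1)%N -> Q`_i = Q'`_i) -> (Q * P)`_k = (Q' * P)`_k.
  by move=> QQ'; rewrite !coefM; apply: eq_bigr => i _; rewrite QQ'.
rewrite (@tr_mul k.+1 p) // (@tr_mul k.+1 _ r) //.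
rewrite (Hl _ _ (tr k.+1 q * tr k.+1 r)) => [|i ik]; last first.
  by rewrite coef_poly ik (@tr_mul k.+1).
rewrite (Hr _ (tr k.+1 (fps_mul p q)) (tr k.+1 p * tr k.+1 q)) ?mulrA // => i ik.
by rewrite coef_poly ik (@tr_mul k.+1).
Qed.

Let mul1 : left_id (fpsC 1) fps_mul.
Proof.
move=> p; apply: fpsP => k /=; rewrite big_ord_recl /= big1 => [|i _].
  by rewrite coef1 mul1r addr0 subn0.
by rewrite coef1 mul0r.
Qed.
Let mulq1 : right_id (fpsC 1) fps_mul.
Proof.
move=> p; apply: fpsP => k /=; rewrite big_ord_recr /= big1 => [|i _].
  by rewrite subnn coef1 mulr1 add0r.
by rewrite coef1 subn_eq0 leqNgt ltn_ord mulr0.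
Qed.
Let mulDl : left_distributive fps_mul fps_add.
Proof.
move=> p q r; apply: fpsP => k /=; rewrite -big_split /=.
by apply: eq_bigr => i _; rewrite mulrDl.
Qed.
Let mulDr : right_distributive fps_mul fps_add.
Proof.
move=> p q r; apply: fpsP => k /=; rewrite -big_split /=.
by apply: eq_bigr => i _; rewrite mulrDr.
Qed.
Let fps1_neq0 : fpsC 1 != 0 :> fps F.
Proof.
apply/eqP => /(congr1 (fun p => fps_coef p 0)) /eqP.
by rewrite /= !coefC /= oner_eq0.
Qed.

HB.instance Definition _ :=
  GRing.Zmodule_isNzRing.Build (fps F) mulA mul1 mulq1 mulDl mulDr fps1_neq0.

Definition fps_eval0 p : F := fps_coef p 0.

(* The quotient of [p] by [fps_eps] when [fps_eval0 p = 0]. *)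
Definition fps_div_eps p : fps F := Fps (fun k => fps_coef p k.+1).

Lemma fps_div_epsK p : fps_eval0 p = 0 -> fps_eps * fps_div_eps p = p.
Proof.
move=> p0; apply: fpsP => -[|k] /=.
  by rewrite big_ord1 coefX mul0r; exact: esym.
rewrite big_ord_recl coefX mul0r add0r big_ord_recl coefX mul1r /= subSS subn0.
by rewrite big1 ?addr0 // => i _; rewrite coefX mul0r.
Qed.

End PowerSeries.

Record laurent (F : nzRingType) : Type := Laurent {
  laurent_coef : int -> F;
  laurent_bounded : exists N : int, forall k, k < N -> laurent_coef k = 0
}.

HB.instance Definition _ (F : nzRingType) := gen_eqMixin (laurent F).
HB.instance Definition _ (F : nzRingType) := gen_choiceMixin (laurent F).

Section LaurentSeries.
Variable F : nzRingType.
Implicit Types f g : laurent F.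

Lemma laurentP f g : laurent_coef f =1 laurent_coef g -> f = g.
Proof.
case: f g => [f bf] [g bg] /= /funext fg; rewrite fg in bf *.
by rewrite (Prop_irrelevance bf bg).
Qed.

(* The coefficients of [p / eps ^+ m]. *)
Definition shift_coef (m : nat) (p : fps F) (k : int) : F :=
  if k + m%:Z is Posz i then fps_coef p i else 0.

Lemma shift_coef_bounded m p :
  exists N : int, forall k, k < N -> shift_coef m p k = 0.
Proof.
exists (- m%:Z) => k; rewrite -subr_lt0 opprK /shift_coef.
by case: (k + m%:Z).
Qed.

Lemma shift_coefD m p k (i : nat) :
  k + m%:Z = i%:Z -> shift_coef m p k = fps_coef p i.
Proof. by rewrite /shift_coef => ->. Qed.

Lemma shift_coef_neg m p k : k + m%:Z < 0 -> shift_coef m p k = 0.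
Proof. by rewrite /shift_coef; case: (k + m%:Z). Qed.

Definition fps_shift m p : laurent F := Laurent (shift_coef_bounded m p).

Definition laurent_of_fps p : laurent F := fps_shift 0 p.

Lemma laurent_of_fpsE p (k : nat) :
  laurent_coef (laurent_of_fps p) k%:Z = fps_coef p k.
Proof. by rewrite /= (@shift_coefD _ _ _ k) ?addr0. Qed.

Lemma laurent_of_fps_neg p k : k < 0 -> laurent_coef (laurent_of_fps p) k = 0.
Proof. by move=> k0; rewrite /= shift_coef_neg ?addr0. Qed.

Lemma laurent_shift f : exists m p, f = fps_shift m p.
Proof.
case: (laurent_bounded f) => N fN.
have fN' k : k < - `|N|%N%:Z -> laurent_coef f k = 0.
  by move=> kN; apply: fN; apply: lt_le_trans kN _; rewrite abszE lerNl ler_normr lexx orbT.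
exists `|N|%N, (Fps (fun i => laurent_coef f (i%:Z - `|N|%N%:Z))).
apply: laurentP => k; rewrite [RHS]/=.
case E: (k + `|N|%N%:Z) => [i|i].
  by rewrite (shift_coefD _ E) /= -E addrK.
have Elt : k + `|N|%N%:Z < 0 by rewrite E.
by rewrite shift_coef_neg // fN' // -subr_lt0 opprK.
Qed.

Definition laurent_add_coef (f g : int -> F) k := f k + g k.

(* The support of the sum is finite when [f] and [g] are Laurent series. *)
Definition laurent_mul_coef (f g : int -> F) k : F :=
  \sum_(i \in [set: int]) f i * g (k - i).

Lemma mul_coef_shift m p n q :
  laurent_mul_coef (shift_coef m p) (shift_coef n q) =
  shift_coef (m + n) (p * q).
Proof.
apply/funext => k; rewrite /laurent_mul_coef.
case E: (k + (m + n)%N%:Z) => [j|j]; last first.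
  have Elt : k + (m + n)%N%:Z < 0 by rewrite E.
  rewrite (shift_coef_neg _ Elt) fsbig1 // => i _.
  have [im|im] := ltP (i + m%:Z) 0; first by rewrite shift_coef_neg ?mul0r.
  rewrite [X in _ * X]shift_coef_neg ?mulr0 //.
  apply: le_lt_trans Elt; rewrite PoszD addrA -subr_ge0.
  by have -> : k + m%:Z + n%:Z - (k - i + n%:Z) = i + m%:Z by lia.
rewrite (shift_coefD _ E).
rewrite (fsbigE [seq a%:Z - m%:Z | a <- iota 0 j.+1]) //.
- have -> : iota 0 j.+1 = index_iota 0 j.+1 by rewrite /index_iota subn0.
  rewrite big_map big_mkord; apply: eq_big => [a|a _]; first by rewrite in_setT.
  rewrite (@shift_coefD _ _ _ a) ?subrK //.
  by rewrite (@shift_coefD _ _ _ (j - a)%N) //; have := ltn_ord a; lia.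
- by rewrite map_inj_uniq ?iota_uniq // => a b /addIr [].
move=> i _ ir.
have [im|] := ltP (i + m%:Z) 0; first by rewrite shift_coef_neg ?mul0r.
case Ei: (i + m%:Z) => [a|//] _.
have aj : (j < a)%N.
  rewrite ltnNge; apply: contra ir => aj; apply/mapP; exists a.
    by rewrite mem_iota add0n.
  by rewrite -Ei addrK.
by rewrite [X in _ * X]shift_coef_neg ?mulr0 //; lia.
Qed.

Lemma shift_raise m j p : exists q, fps_shift m p = fps_shift (m + j) q.
Proof.
exists (Fps (fun i => if (i < j)%N then 0 else fps_coef p (i - j))).
apply: laurentP => k /=; case E: (k + (m + j)%N%:Z) => [i|i].
  rewrite (shift_coefD _ E) /=; case: ltnP => ij.
    by rewrite shift_coef_neg //; lia.
  by rewrite (@shift_coefD _ _ _ (i - j)%N) //; lia.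
by rewrite !shift_coef_neg //; lia.
Qed.

Lemma laurent_shift2 f g : exists m p q, f = fps_shift m p /\ g = fps_shift m q.
Proof.
have [m [p ->]] := laurent_shift f; have [n [q ->]] := laurent_shift g.
have [p' ->] := shift_raise m n p; have [q' ->] := shift_raise n m q.
by exists (m + n)%N, p', q'; split=> //; rewrite addnC.
Qed.

Lemma add_coef_shift m p q :
  laurent_add_coef (shift_coef m p) (shift_coef m q) = shift_coef m (p + q).
Proof.
apply/funext => k; rewrite /laurent_add_coef /shift_coef.
by case: (k + m%:Z) => // i; rewrite addr0.
Qed.

Lemma laurent_add_bounded f g : exists N : int, forall k, k < N ->
  laurent_add_coef (laurent_coef f) (laurent_coef g) k = 0.
Proof.
have [m [p [q [-> ->]]]] := laurent_shift2 f g.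
by rewrite add_coef_shift; apply: shift_coef_bounded.
Qed.

Lemma laurent_mul_bounded f g : exists N : int, forall k, k < N ->
  laurent_mul_coef (laurent_coef f) (laurent_coef g) k = 0.
Proof.
have [m [p ->]] := laurent_shift f; have [n [q ->]] := laurent_shift g.
by rewrite mul_coef_shift; apply: shift_coef_bounded.
Qed.

Lemma laurent_opp_bounded f : exists N : int, forall k, k < N ->
  - laurent_coef f k = 0.
Proof.
by have [N fN] := laurent_bounded f; exists N => k /fN ->; rewrite oppr0.
Qed.

Definition laurent_add f g := Laurent (laurent_add_bounded f g).
Definition laurent_opp f := Laurent (laurent_opp_bounded f).
Definition laurent_mul f g := Laurent (laurent_mul_bounded f g).

Lemma laurent_mul_shift m p n q :
  laurent_mul (fps_shift m p) (fps_shift n q) = fps_shift (m + n) (p * q).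
Proof. by apply: laurentP => k /=; rewrite mul_coef_shift. Qed.

Lemma laurent_add_shift m p q :
  laurent_add (fps_shift m p) (fps_shift m q) = fps_shift m (p + q).
Proof. by apply: laurentP => k /=; rewrite add_coef_shift. Qed.

Let addA : associative laurent_add.
Proof. by move=> f g h; apply: laurentP => k /=; rewrite /laurent_add_coef addrA. Qed.
Let addC : commutative laurent_add.
Proof. by move=> f g; apply: laurentP => k /=; rewrite /laurent_add_coef addrC. Qed.
Let laurent0E k : laurent_coef (laurent_of_fps 0) k = 0.
Proof.
rewrite /= /shift_coef addr0; case: k => //= i; exact: coef0.
Qed.
Let add0 : left_id (laurent_of_fps 0) laurent_add.
Proof.
move=> f; apply: laurentP => k.
by rewrite -[RHS]add0r -[0 in RHS](laurent0E k).
Qed.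
Let addN : left_inverse (laurent_of_fps 0) laurent_opp laurent_add.
Proof.
move=> f; apply: laurentP => k.
by rewrite [RHS]laurent0E /= /laurent_add_coef /= addNr.
Qed.

HB.instance Definition _ :=
  GRing.isZmodule.Build (laurent F) addA addC add0 addN.

Let mulA : associative laurent_mul.
Proof.
move=> f g h.
have [m [p ->]] := laurent_shift f; have [n [q ->]] := laurent_shift g.
have [k [r ->]] := laurent_shift h.
by rewrite !laurent_mul_shift mulrA addnA.
Qed.
Let mul1 : left_id (laurent_of_fps 1) laurent_mul.
Proof.
by move=> f; have [m [p ->]] := laurent_shift f; rewrite laurent_mul_shift mul1r.
Qed.
Let mulq1 : right_id (laurent_of_fps 1) laurent_mul.
Proof.
move=> f; have [m [p ->]] := laurent_shift f.
by rewrite laurent_mul_shift mulr1 addn0.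
Qed.
Let mulDl : left_distributive laurent_mul laurent_add.
Proof.
move=> f g h; have [m [p [q [-> ->]]]] := laurent_shift2 f g.
have [k [r ->]] := laurent_shift h.
by rewrite laurent_add_shift !laurent_mul_shift laurent_add_shift mulrDl.
Qed.
Let mulDr : right_distributive laurent_mul laurent_add.
Proof.
move=> f g h; have [m [p [q [-> ->]]]] := laurent_shift2 g h.
have [k [r ->]] := laurent_shift f.
by rewrite laurent_add_shift !laurent_mul_shift laurent_add_shift mulrDr.
Qed.
Let laurent1_neq0 : laurent_of_fps 1 != 0 :> laurent F.
Proof.
apply/eqP => /(congr1 (fun f => laurent_coef f 0)) /eqP.
by rewrite laurent0E (laurent_of_fpsE 1 0) /= coefC /= oner_eq0.
Qed.

HB.instance Definition _ :=
  GRing.Zmodule_isNzRing.Build (laurent F) mulA mul1 mulq1 mulDl mulDr laurent1_neq0.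

Let laurent_of_fps_zmod : {morph laurent_of_fps : p q / p - q}.
Proof.
move=> p q; apply: laurentP => k /=; rewrite /laurent_add_coef /= /shift_coef.
by case: (k + 0) => // i; rewrite subr0.
Qed.

HB.instance Definition _ :=
  GRing.isZmodMorphism.Build (fps F) (laurent F) laurent_of_fps laurent_of_fps_zmod.

Let laurent_of_fps_monoid : monoid_morphism laurent_of_fps.
Proof. by split=> // p q; rewrite /GRing.mul /= laurent_mul_shift. Qed.

HB.instance Definition _ :=
  GRing.isMonoidMorphism.Build (fps F) (laurent F) laurent_of_fps
    laurent_of_fps_monoid.

End LaurentSeries.

Definition is_skew_field (D : unitRingType) : Prop :=
  forall x : D, x != 0 -> x \is a GRing.unit.

(* By the Ore condition, such a [D] is determined by [A] up to a unique
   isomorphism compatible with [iota]. *)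
Definition is_quotient_skew_field (A : pzRingType) (D : unitRingType)
    (iota : {rmorphism A -> D}) : Prop :=
  [/\ is_skew_field D, injective iota
    & forall x : D, exists a b : A, iota b != 0 /\ x = iota a / iota b].

Notation free_alg C I := {malg C[{fmonom I}]} (only parsing).

Definition free_gen (C : comNzRingType) (I : choiceType) (i : I) :
  free_alg C I := << fmu i >>.

Section Presentation.
Variables (C : comNzRingType) (I : choiceType) (rel : free_alg C I -> Prop).

(* The relations are [x = 0] for the [x] such that [rel x]. *)
Definition presented_gen (i : I) : quot_ring rel := quot_pi rel (free_gen C i).
Definition presented_scalar (c : C) : quot_ring rel := quot_pi rel (c%:A).

End Presentation.

Definition commutator (A : pzRingType) (x y : A) : A := x * y - y * x.

(* Indices modulo [m] are represented by natural numbers. *)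
Definition cyc_next (m i j : nat) : bool := j == i.+1 %[mod m].

(* The generalized Cartan matrix of type [A_(m-1)^(1)], for [2 < m]. *)
Definition cartan (m i j : nat) : int :=
  if i == j %[mod m] then 2
  else if cyc_next m i j || cyc_next m j i then -1 else 0.

Definition umat (m i j : nat) : int :=
  if cyc_next m i j then 1 else if cyc_next m j i then -1 else 0.

Definition ell (n : nat) : nat := (2 * n)%N.+1.

Variant Kgen (n : nat) : Type :=
| Kgen_f of 'I_(ell n).+1
| Kgen_alpha of 'I_(ell n).+1
| Kgen_h.

HB.instance Definition _ n := gen_eqMixin (Kgen n).
HB.instance Definition _ n := gen_choiceMixin (Kgen n).

Variant Fgen (n : nat) : Type :=
| Fgen_phi of 'I_(ell n).+1
| Fgen_beta of 'I_(ell n).+1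
| Fgen_t
| Fgen_h.

HB.instance Definition _ n := gen_eqMixin (Fgen n).
HB.instance Definition _ n := gen_choiceMixin (Fgen n).

Section Algebras.
Variables (R : realType) (n : nat).
Let l := ell n.
Let C : comNzRingType := complex R.

Section Krel.
Let X (g : Kgen n) : free_alg C (Kgen n) := free_gen C g.
Let f (i : nat) := X (Kgen_f (inZp i)).
Let alpha (i : nat) := X (Kgen_alpha (inZp i)).
Let h := X (Kgen_h n).

Inductive Krel : free_alg C (Kgen n) -> Prop :=
| Krel_ff_next i : Krel (commutator (f i) (f i.+1) - h)
| Krel_ff i j : ~~ cyc_next l.+1 i j -> ~~ cyc_next l.+1 j i ->
    Krel (commutator (f i) (f j))
| Krel_alpha i g : Krel (commutator (alpha i) (X g))
| Krel_h g : Krel (commutator h (X g))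
| Krel_f_even : Krel (\sum_(0 <= k < n.+1) f (2 * k)%N - 1)
| Krel_f_odd : Krel (\sum_(0 <= k < n.+1) f (2 * k)%N.+1 - 1).
End Krel.

Section Frel.
Let X (g : Fgen n) : free_alg C (Fgen n) := free_gen C g.
Let phi (i : nat) := X (Fgen_phi (inZp i)).
Let beta (i : nat) := X (Fgen_beta (inZp i)).
Let t := X (Fgen_t n).
Let h := X (Fgen_h n).

Inductive Frel : free_alg C (Fgen n) -> Prop :=
| Frel_phi_next i : Frel (commutator (phi i) (phi i.+1) - h)
| Frel_phi i j : ~~ cyc_next l.+1 i j -> ~~ cyc_next l.+1 j i ->
    Frel (commutator (phi i) (phi j))
| Frel_beta i g : Frel (commutator (beta i) (X g))
| Frel_t g : Frel (commutator t (X g))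
| Frel_h g : Frel (commutator h (X g))
| Frel_phi_even : Frel (\sum_(0 <= k < n.+1) phi (2 * k)%N)
| Frel_phi_odd : Frel (\sum_(0 <= k < n.+1) phi (2 * k)%N.+1)
| Frel_beta_sum : Frel (\sum_(0 <= k < l.+1) beta k - 1).
End Frel.

End Algebras.

Notation Kalg R n := (quot_ring (@Krel R n)).
Notation Falg R n := (quot_ring (@Frel R n)).

Section SkewFieldK.
Variables (R : realType) (n : nat) (K : unitRingType).
Variable iK : {rmorphism Kalg R n -> K}.
Let l := ell n.

Definition K_f (i : nat) : K := iK (presented_gen _ (Kgen_f (inZp i))).
Definition K_alpha (i : nat) : K := iK (presented_gen _ (Kgen_alpha (inZp i))).
Definition K_h : K := iK (presented_gen _ (Kgen_h n)).
Definition K_scalar (c : complex R) : K := iK (presented_scalar _ c).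

Definition is_reflection_K (i : 'I_l.+1) (s : {rmorphism K -> K}) : Prop :=
  [/\ bijective s,
      forall c, s (K_scalar c) = K_scalar c,
      forall j, s (K_f j) = K_f j + (K_alpha i / K_f i) *~ umat l.+1 i j,
      forall j, s (K_alpha j) = K_alpha j - K_alpha i *~ cartan l.+1 i j
    & s K_h = K_h].

Definition is_rotation_K (pi : {rmorphism K -> K}) : Prop :=
  [/\ bijective pi,
      forall c, pi (K_scalar c) = K_scalar c,
      forall j, pi (K_f j) = K_f j.+1,
      forall j, pi (K_alpha j) = K_alpha j.+1
    & pi K_h = K_h].

Variables (s : 'I_l.+1 -> {rmorphism K -> K}) (pi : {rmorphism K -> K}).

(* [foldl] applies s_1 first: [T1_K x = pi (s_l (... (s_1 x)))]. *)
Definition T1_K (x : K) : K :=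
  pi (foldl (fun y i => s (inZp i) y) x (iota 1 l)).

Definition r_K (i : nat) (x : K) : K :=
  if i == 0%N then s (inZp 0) (s (inZp 1) (s (inZp 0) x)) else s (inZp i.+1) x.

End SkewFieldK.

Section SkewFieldF.
Variables (R : realType) (n : nat) (F : unitRingType).
Variable iF : {rmorphism Falg R n -> F}.
Let l := ell n.

Definition F_phi (i : nat) : F := iF (presented_gen _ (Fgen_phi (inZp i))).
Definition F_beta (i : nat) : F := iF (presented_gen _ (Fgen_beta (inZp i))).
Definition F_t : F := iF (presented_gen _ (Fgen_t n)).
Definition F_h : F := iF (presented_gen _ (Fgen_h n)).
Definition F_scalar (c : complex R) : F := iF (presented_scalar _ c).

Definition F_psi (i : nat) : F :=
  if (i %% l)%N is j.+1 then F_phi j.+2 else F_phi 0 + F_phi 1 + F_t.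

Definition F_gamma (i : nat) : F :=
  if (i %% l)%N is j.+1 then F_beta j.+2 else F_beta 0 + F_beta 1.

Variables (Fe : unitRingType) (iFe : {rmorphism {poly F} -> Fe}).

Let eps : Fe := iFe 'X.
Let cst (x : F) : Fe := iFe x%:P.

Definition is_Psi (K : unitRingType) (iK : {rmorphism Kalg R n -> K})
    (Psi : {rmorphism K -> Fe}) : Prop :=
  [/\ forall c, Psi (K_scalar iK c) = cst (F_scalar c),
      [/\ Psi (K_f iK 0) = 1 + eps * cst (F_phi 0),
          Psi (K_f iK 1) = 1 + eps * cst (F_phi 1)
        & forall i, (2 <= i <= l)%N -> Psi (K_f iK i) = eps * cst (F_phi i)],
      [/\ Psi (K_alpha iK 0) = -1 + eps * cst F_t + eps ^+ 2 * cst (F_beta 0),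
          Psi (K_alpha iK 1) = 1 - eps * cst F_t + eps ^+ 2 * cst (F_beta 1)
        & forall i, (2 <= i <= l)%N ->
            Psi (K_alpha iK i) = eps ^+ 2 * cst (F_beta i)]
    & Psi (K_h iK) = eps ^+ 2 * cst F_h].

(* The embedding of polynomials extends in exactly one way to their quotient skew
   field; this extension is the Laurent expansion at [eps = 0]. *)
Definition is_expansion (E : {rmorphism Fe -> laurent F}) : Prop :=
  forall P : {poly F}, E (iFe P) = laurent_of_fps (fps_of_poly P).

Variables (K : unitRingType) (iK : {rmorphism Kalg R n -> K}).
Variables (s : 'I_l.+1 -> {rmorphism K -> K}) (pi : {rmorphism K -> K}).
Variables (Psi : {rmorphism K -> Fe}) (E : {rmorphism Fe -> laurent F}).

Definition is_T1_action (T : {rmorphism fps F -> fps F}) : Prop :=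
  [/\ bijective T,
      [/\ forall c, T (fpsC (F_scalar c)) = fpsC (F_scalar c),
          T (fps_eps F) = fps_eps F
        & T (fpsC F_h) = fpsC F_h],
      T (fpsC F_t) = fpsC F_t + fps_eps F,
      forall i, (i <= l)%N -> T (fpsC (F_beta i)) = fpsC (F_beta i)
    & forall i, (1 <= i <= l.-1)%N ->
        laurent_of_fps (T (fpsC (F_psi i))) =
        E (Psi (T1_K s pi (K_f iK i.+1)) / eps)].

Definition is_r_action (i : nat) (r : {rmorphism fps F -> fps F}) : Prop :=
  [/\ bijective r,
      [/\ forall c, r (fpsC (F_scalar c)) = fpsC (F_scalar c),
          r (fps_eps F) = fps_eps F, r (fpsC F_h) = fpsC F_h
        & r (fpsC F_t) = fpsC F_t],
      forall j, (j <= l.-1)%N ->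
        r (fpsC (F_gamma j)) = fpsC (F_gamma j - F_gamma i *~ cartan l i j),
      r (fpsC (F_beta 0)) =
        fpsC (if i == 0%N then - F_beta 1
              else if i == l.-1 then F_beta 0 + F_beta l
              else F_beta 0)
    & forall j, (1 <= j <= l.-1)%N ->
        laurent_of_fps (r (fpsC (F_psi j))) =
        E (Psi (r_K s i (K_f iK j.+1)) / eps)].

End SkewFieldF.

(* The value at [eps = 0] of [(T x - x) / eps]; the division is exact when [T] is
   the identity modulo [eps]. *)
Definition eps_derivation (F : nzRingType) (T : fps F -> fps F) (x : F) : F :=
  fps_eval0 (fps_div_eps (T (fpsC x) - fpsC x)).

(* The map induced by [r] on [fps F / eps * fps F], which is identified with [F]
   through constant series. *)
Definition reduction (F : nzRingType) (r : fps F -> fps F) (x : F) : F :=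
  fps_eval0 (r (fpsC x)).

(* Main.v *)
From HB Require Import structures.
Require Import Defs.
From mathcomp Require Import all_boot all_order all_algebra.
From mathcomp Require Import reals complex.
From mathcomp Require Import monalg.
From mathcomp Require Import zify.

Set Implicit Arguments.
Unset Strict Implicit.
Unset Printing Implicit Defensive.

Import GRing.Theory.
Local Open Scope ring_scope.

(** The skew field [F] sits inside [F((eps))], and the translation [T1], transported by
    [Psi], becomes an automorphism congruent to the identity modulo [eps]; its first
    order part is the derivation. Both claims are obtained by computing enough
    coefficients in [eps].

    For the derivation, write [y_j] for the image of [f j] under [s_l ... s_(j+1)]. These
    elements form a continued fraction [y_j = f_j - a_(j+1) / y_(j+1)] with numerators
    [a_j = alpha_j + ... + alpha_l], and the translate of [f (j+1)] is the image under
    [pi] of [y_(j+1) + a_j / y_j] ([swept_fS], [T1_K_f]). After applying [pi] and [Psi],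
    each [y_j] expands as [1 - eps S_j + ...], where [S_j] is the sum of
    [psi (j + 2 k - 1)] over [1 <= k <= n] ([expands_swept_f]). Comparing coefficients of
    [eps^2] in the two displayed equations, multiplied out, gives
    [psi_i S_i - S_(i+1) psi_i + gamma_i] for [0 < i] ([T_psi_coef]). The case [i = 0]
    follows since the [psi_i] add up to [t], whose derivative is [1], and the right-hand
    sides add up to [1] as well ([delta_psi]).

    For the commutation, the reflection [r_i] at [eps = 0] is computed to be
    [psi_j |-> psi_j + u_ij gamma_i / psi_i] ([reduced_psi]). The relation
    [S_j + S_(j+1) + psi_j = t] shows that it changes only [S_i] and [S_(i+1)], by
    [gamma_i / psi_i] and its opposite, and the commutation on each [psi_j] becomes a
    short identity in a noncommutative ring ([rho_delta_psi]). It propagates from the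
    generators to all of [F], since both composites are derivations along the same
    morphism ([reduced_delta]).

    The [psi_i] are invertible because of the differential equation itself: [psi_i = 0]
    would force [gamma_i = 0], the reflections would then annihilate every [gamma_j], and
    yet these add up to [1] ([psi_unit]). *)

(** * Identities in noncommutative rings *)

Lemma pull_term (V : zmodType) (x y s r : V) : s = y + r -> x + s = y + (x + r).
Proof. by move=> ->; rewrite addrCA. Qed.

Lemma cancel_neg (V : zmodType) (x s r : V) : s = x + r -> r = 0 -> - x + s = 0.
Proof. by move=> -> ->; rewrite addr0 addNr. Qed.

Lemma cancel_pos (V : zmodType) (x s r : V) : s = - x + r -> r = 0 -> x + s = 0.
Proof. by move=> -> ->; rewrite addr0 addrN. Qed.

Ltac pull_pos x s :=
  match s with
  | @GRing.add _ ?z ?r =>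
    let _ := match constr:(Set) with _ => unify x z end in constr:(erefl s : s = x + r)
  | @GRing.add _ ?z ?r => let e := pull_pos x r in constr:(pull_term z e)
  end.

Ltac pull_neg x s :=
  match s with
  | @GRing.add _ (@GRing.opp _ ?z) ?r =>
    let _ := match constr:(Set) with _ => unify x z end in constr:(erefl s : s = - x + r)
  | @GRing.add _ ?z ?r => let e := pull_neg x r in constr:(pull_term z e)
  end.

Ltac cancel_head :=
  match goal with
  | |- @GRing.add _ (@GRing.opp _ ?x) ?s = _ =>
    let e := pull_pos x s in apply: (cancel_neg e)
  | |- @GRing.add _ ?x ?s = _ => let e := pull_neg x s in apply: (cancel_pos e)
  end.

(** A stand-in for the ring tactic where multiplication does not commute: both sides
    are expanded into signed words in the atoms, which then have to cancel in pairs. *)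
Ltac noncomm :=
  apply: subr0_eq;
  rewrite ?(mulrDl, mulrDr, mulNr, mulrN, opprD, opprK, mulrA, mul0r, mulr0, mul1r,
            mulr1, oppr0);
  rewrite -[LHS]addr0 -?addrA ?add0r; repeat cancel_head; reflexivity.

(** * Induction on presented algebras and their quotient skew fields *)

Lemma free_alg_scalarE (C : comNzRingType) (I : choiceType) (c : C) :
  c%:A = << c *g mone >> :> free_alg C I.
Proof. by rewrite -mul_malgC mulr1. Qed.

Lemma free_alg_scalar_central (C : comNzRingType) (I : choiceType) (c : C)
    (x : free_alg C I) : GRing.comm x c%:A.
Proof.
rewrite [x]monalgE; apply: commr_sym; apply: commr_sum => k _; rewrite free_alg_scalarE.
by rewrite /GRing.comm !malgM_def !fgmulUU mul1m mulm1 mulrC.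
Qed.

(** Negation is covered by multiplication by the scalar [-1]. *)
Lemma presented_ind (C : comNzRingType) (I : choiceType)
    (rel : free_alg C I -> Prop) (P : quot_ring rel -> Prop) :
  (forall c, P (presented_scalar rel c)) -> (forall i, P (presented_gen rel i)) ->
  (forall x y, P x -> P y -> P (x + y)) ->
  (forall x y, P x -> P y -> P (x * y)) -> forall x, P x.
Proof.
move=> Pc Pg PD PM x; have -> : x = quot_pi rel (repr x) by rewrite /quot_pi reprK.
rewrite [repr x]monalgE; apply: (big_ind (fun y => P (quot_pi rel y))).
- by have := Pc 0; rewrite /presented_scalar scale0r.
- by move=> y z Py Pz; rewrite rmorphD; apply: PD.
move=> k _; set c := mcoeff _ _; case: k @c => k c.
have -> : << c *g FMonom k >> = c%:A * << FMonom k >> :> free_alg C I.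
  by rewrite free_alg_scalarE malgM_def fgmulUU mulr1 mul1m.
rewrite rmorphM; apply: (PM _ _ (Pc c)) => {c}.
elim: k => [|i k IH].
  by have := Pc 1; rewrite /presented_scalar scale1r -fmoneE.
have -> : << FMonom (i :: k) >> = << fmu i >> * << FMonom k >> :> free_alg C I.
  rewrite malgM_def fgmulUU mulr1; congr << _ *g _ >>.
  by rewrite /mmul /= fmmulE fmuE.
by rewrite rmorphM; apply: PM => //; apply: Pg.
Qed.

(** Being a fraction reduces everything to the algebra, so that a closed property needs
    to be checked on the generators only. This is how centrality, the congruence of the
    translation with the identity and the commutation of the derivation with the
    reflections are all established. *)
Lemma quotient_skew_field_ind (C : comNzRingType) (I : choiceType)
    (rel : free_alg C I -> Prop) (D : unitRingType)
    (iota : {rmorphism quot_ring rel -> D}) (P : D -> Prop) :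
  is_quotient_skew_field iota ->
  (forall c, P (iota (presented_scalar rel c))) ->
  (forall i, P (iota (presented_gen rel i))) ->
  (forall x y, P x -> P y -> P (x + y)) ->
  (forall x y, P x -> P y -> P (x * y)) ->
  (forall x, x \is a GRing.unit -> P x -> P x^-1) -> forall x, P x.
Proof.
move=> [skew _ frac] Pc Pg PD PM PV x.
have Palg a : P (iota a).
  apply: (@presented_ind _ _ _ (fun a => P (iota a))) => // {a}.
  - by move=> a b Pa Pb; rewrite rmorphD; apply: PD.
  - by move=> a b Pa Pb; rewrite rmorphM; apply: PM.
by have [a [b [b0 ->]]] := frac x; apply: PM => //; apply: PV => //; apply: skew.
Qed.

(** Valid at [0] as well, whose inverse is [0] by convention; hence no denominator needs
    to be shown nonzero as long as the computation stays inside [K]. *)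
Lemma skew_rmorphV (D D' : unitRingType) (f : {rmorphism D -> D'}) :
  is_skew_field D -> forall x, f x^-1 = (f x)^-1.
Proof.
move=> skew x; have [->|/skew] := eqVneq x 0; first by rewrite !(invr0, rmorph0).
exact: rmorphV.
Qed.

(** * Power series and their low order coefficients *)

Section PowerSeriesTheory.
Variable F : nzRingType.
Implicit Types p q : fps F.

Lemma fps_coefD p q k : fps_coef (p + q) k = fps_coef p k + fps_coef q k.
Proof. by []. Qed.

Lemma fps_coefN p k : fps_coef (- p) k = - fps_coef p k.
Proof. by []. Qed.

Lemma fps_coefMz p m k : fps_coef (p *~ m) k = fps_coef p k *~ m.
Proof.
have Mn j : fps_coef (p *+ j) k = fps_coef p k *+ j.
  elim: j => [|j IH]; first exact: coef0.
  by rewrite !mulrS fps_coefD IH.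
by case: m => m; rewrite ?NegzE ?mulrNz -!pmulrn ?fps_coefN Mn.
Qed.

Lemma fps_coef0 k : fps_coef (0 : fps F) k = 0.
Proof. exact: coef0. Qed.

Lemma fps_coef1 k : fps_coef (1 : fps F) k = (k == 0%N)%:R.
Proof. exact: coef1. Qed.

Lemma fps_coefC (c : F) k : fps_coef (fpsC c) k = if k == 0%N then c else 0.
Proof. exact: coefC. Qed.

Lemma fps_coefX k : fps_coef (fps_eps F) k = (k == 1%N)%:R.
Proof. exact: coefX. Qed.

Lemma fps_coefM p q k :
  fps_coef (p * q) k = \sum_(i < k.+1) fps_coef p i * fps_coef q (k - i).
Proof. by []. Qed.

Lemma fps_coefM0 p q : fps_coef (p * q) 0 = fps_coef p 0 * fps_coef q 0.
Proof. by rewrite fps_coefM big_ord1. Qed.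

Lemma fps_coefM1 p q :
  fps_coef (p * q) 1 = fps_coef p 0 * fps_coef q 1 + fps_coef p 1 * fps_coef q 0.
Proof. by rewrite fps_coefM 2!big_ord_recr big_ord0 /= add0r. Qed.

Lemma fps_coefM2 p q :
  fps_coef (p * q) 2 = fps_coef p 0 * fps_coef q 2 + fps_coef p 1 * fps_coef q 1
                       + fps_coef p 2 * fps_coef q 0.
Proof. by rewrite fps_coefM 3!big_ord_recr big_ord0 /= add0r. Qed.

Lemma fps_coefMX p k :
  fps_coef (p * fps_eps F) k = if k is k'.+1 then fps_coef p k' else 0.
Proof.
rewrite fps_coefM; under eq_bigr do rewrite fps_coefX.
rewrite big_ord_recr /= subnn mulr0 addr0; case: k => [|k]; first by rewrite big_ord0.
rewrite big_ord_recr /= subSnn mulr1 big1 ?add0r // => i _.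
by case: eqP => [|_]; rewrite ?mulr0 //; have := ltn_ord i; lia.
Qed.

Lemma fps_commX p : p * fps_eps F = fps_eps F * p.
Proof.
apply: fpsP => k; rewrite fps_coefMX fps_coefM; under eq_bigr do rewrite fps_coefX.
case: k => [|k]; first by rewrite big_ord1 mul0r.
by rewrite !big_ord_recl /= mul0r mul1r add0r subn1 big1 ?addr0 // => i _; rewrite mul0r.
Qed.

Lemma fps_mulIX p q : p * fps_eps F = q * fps_eps F -> p = q.
Proof.
move=> pq; apply: fpsP => k.
by have := congr1 (fun r => fps_coef r k.+1) pq; rewrite !fps_coefMX.
Qed.

Lemma fpsCB : {morph @fpsC F : x y / x - y}.
Proof.
move=> x y; apply: fpsP => k; rewrite fps_coefD fps_coefN !fps_coefC.
by case: eqP => // _; rewrite subr0.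
Qed.

Lemma fpsCM : monoid_morphism (@fpsC F).
Proof.
split=> [//|x y]; apply: fpsP => k; rewrite fps_coefM big_ord_recl subn0 !fps_coefC.
case: eqP => [-> |_]; first by rewrite big_ord0 addr0.
by rewrite mulr0 add0r big1 // => i _; rewrite fps_coefC mul0r.
Qed.

HB.instance Definition _ := GRing.isZmodMorphism.Build F (fps F) (@fpsC F) fpsCB.
HB.instance Definition _ := GRing.isMonoidMorphism.Build F (fps F) (@fpsC F) fpsCM.

Lemma fps_eval0B : {morph @fps_eval0 F : p q / p - q}.
Proof. by []. Qed.

Lemma fps_eval0M : monoid_morphism (@fps_eval0 F).
Proof. by split=> [|p q]; [exact: fps_coef1|exact: fps_coefM0]. Qed.

HB.instance Definition _ :=
  GRing.isZmodMorphism.Build (fps F) F (@fps_eval0 F) fps_eval0B.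
HB.instance Definition _ :=
  GRing.isMonoidMorphism.Build (fps F) F (@fps_eval0 F) fps_eval0M.

Lemma fpsCK : cancel (@fpsC F) (@fps_eval0 F).
Proof. by move=> x; apply: fps_coefC. Qed.

Lemma fps_inv_coef p q : p * q = 1 -> fps_coef p 0 = 1 ->
  fps_coef q 0 = 1 /\ fps_coef q 1 = - fps_coef p 1.
Proof.
move=> pq p0.
have q0 : fps_coef q 0 = 1.
  by have := congr1 (fun r => fps_coef r 0) pq; rewrite fps_coefM0 p0 mul1r fps_coef1.
split=> //; have := congr1 (fun r => fps_coef r 1) pq.
rewrite fps_coefM1 p0 q0 mul1r mulr1 fps_coef1.
by move/eqP; rewrite addr_eq0 => /eqP.
Qed.

Lemma fps_coefXM p k :
  fps_coef (fps_eps F * p) k = if k is k'.+1 then fps_coef p k' else 0.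
Proof. by rewrite -fps_commX fps_coefMX. Qed.

(** The geometric series in [1 - p]: each coefficient of the infinite sum is already
    reached by a partial sum, since [1 - p] has no constant term. *)
Lemma fps_inv1 p : fps_coef p 0 = 1 -> exists q, p * q = 1.
Proof.
move=> p0; pose u := 1 - p.
have u0 : fps_coef u 0 = 0 by rewrite fps_coefD fps_coefN fps_coef1 p0 subrr.
have um m k : (k < m)%N -> fps_coef (u ^+ m) k = 0.
  elim: m k => // m IH k km; rewrite exprS fps_coefM big_ord_recl u0 mul0r add0r.
  by rewrite big1 // => i _; rewrite IH ?mulr0 // lift0; have := ltn_ord i; lia.
pose g m := \sum_(j < m) u ^+ j.
have pg m : p * g m = 1 - u ^+ m.
  elim: m => [|m IH]; first by rewrite /g big_ord0 mulr0 subrr.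
  rewrite /g big_ord_recr /= mulrDr IH -[p](subKr 1) -/u mulrBl mul1r exprS.
  by rewrite addrA subrK.
have g_stable m k : (k < m)%N -> fps_coef (g m) k = fps_coef (g k.+1) k.
  elim: m => // m IH; rewrite ltnS leq_eqVlt => /predU1P[-> //|km].
  by rewrite /g big_ord_recr fps_coefD um // addr0 -/(g m) IH.
exists (Fps (fun k => fps_coef (g k.+1) k)); apply: fpsP => k.
(* The product only sees the coefficients of index at most [k], where the full series and
   its partial sum with [k.+1] terms agree. *)
rewrite -[RHS]subr0 -(um k.+1 k) // -[RHS](congr1 (fun r => fps_coef r k) (pg k.+1)).
by rewrite !fps_coefM; apply: eq_bigr => i _; rewrite /= (g_stable k.+1) //; lia.
Qed.

End PowerSeriesTheory.

Lemma fps_inv (F : unitRingType) (p : fps F) :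
  fps_coef p 0 \is a GRing.unit -> exists q, p * q = 1 /\ q * p = 1.
Proof.
have rinv (r : fps F) :
    fps_coef r 0 \is a GRing.unit -> exists q, r * q = 1.
  move=> r0; set c := fps_coef r 0 in r0.
  have [|q rq] := @fps_inv1 _ (fpsC c^-1 * r).
    by rewrite fps_coefM0 fps_coefC /= mulVr.
  have cV : fpsC c * fpsC c^-1 = 1 by rewrite -rmorphM divrr // rmorph1.
  have {}rq : r * q = fpsC c by rewrite -[r * q]mul1r -cV -mulrA (mulrA _ r) rq mulr1.
  by exists (q * fpsC c^-1); rewrite mulrA rq.
move=> p0; have [q pq] := rinv p p0; exists q; split=> //.
have [|r qr] := rinv q; last first.
  by suff -> : p = r by []; rewrite -[p]mulr1 -qr mulrA pq mul1r.
have /(congr1 (fun r => fps_coef r 0)) := pq; rewrite fps_coefM0 fps_coef1 /= => pq0.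
by rewrite -[fps_coef q 0](mulKr p0) pq0 mulr1 unitrV.
Qed.

Lemma fps_inv_coef0 (F : unitRingType) (p q : fps F) :
  p * q = 1 -> fps_coef p 0 \is a GRing.unit -> fps_coef q 0 = (fps_coef p 0)^-1.
Proof.
move=> /(congr1 (fun r => fps_coef r 0)); rewrite fps_coefM0 fps_coef1 /= => pq p0.
by rewrite -[LHS](mulKr p0) pq mulr1.
Qed.

(** * Power series expansions of elements of the quotient skew field of polynomials *)

Lemma laurent_of_fps_inj (F : nzRingType) : injective (@laurent_of_fps F).
Proof. by move=> p q pq; apply: fpsP => k; rewrite -!laurent_of_fpsE pq. Qed.

Section Expansions.
Variables (F Fe : unitRingType) (iFe : {rmorphism {poly F} -> Fe}).
Variable E : {rmorphism Fe -> laurent F}.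
Hypotheses (Fe_skew : is_skew_field Fe) (iFe_inj : injective iFe).
Hypothesis E_spec : is_expansion iFe E.
Local Notation eps := (iFe 'X).

(** Most elements of [Fe] that occur below are regular at [eps = 0]; this relation lets
    one compute with their expansions in the ring of power series, without ever
    handling genuine Laurent series. *)
Definition expands (x : Fe) (p : fps F) : Prop := E x = laurent_of_fps p.

Lemma expands_fun x p q : expands x p -> expands x q -> p = q.
Proof. by rewrite /expands => -> /laurent_of_fps_inj. Qed.

Lemma expandsC c : expands (iFe c%:P) (fpsC c).
Proof. exact: E_spec. Qed.

Lemma expandsX : expands eps (fps_eps F).
Proof. exact: E_spec. Qed.

Lemma expands1 : expands 1 1.
Proof. by rewrite /expands !rmorph1. Qed.

Lemma expandsD x y p q : expands x p -> expands y q -> expands (x + y) (p + q).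
Proof. by rewrite /expands !rmorphD => -> ->. Qed.

Lemma expandsN x p : expands x p -> expands (- x) (- p).
Proof. by rewrite /expands !rmorphN => ->. Qed.

Lemma expandsB x y p q : expands x p -> expands y q -> expands (x - y) (p - q).
Proof. by move=> xp yq; apply/expandsD/expandsN. Qed.

Lemma expandsM x y p q : expands x p -> expands y q -> expands (x * y) (p * q).
Proof. by rewrite /expands !rmorphM => -> ->. Qed.

Lemma expandsMz x p m : expands x p -> expands (x *~ m) (p *~ m).
Proof. by rewrite /expands !rmorphMz => ->. Qed.

Lemma eps_unit : eps \is a GRing.unit.
Proof.
by apply: Fe_skew; rewrite -(rmorph0 iFe) (inj_eq iFe_inj) polyX_eq0.
Qed.

(** An inverse of a series with invertible constant term is again a power series, and
    inverses are unique; this is what keeps the continued fractions below regular. *)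
Lemma expandsV x p : expands x p -> fps_coef p 0 \is a GRing.unit ->
  exists q, [/\ expands x^-1 q, x \is a GRing.unit, p * q = 1 & q * p = 1].
Proof.
move=> xp p0; have [q [pq qp]] := fps_inv p0; exists q.
have x_unit : x \is a GRing.unit.
  apply: Fe_skew; apply: contraTneq p0 => x0.
  have -> : p = 0 by apply: expands_fun xp _; rewrite x0 /expands !rmorph0.
  by rewrite fps_coef0 unitr0.
split=> //; rewrite /expands -[RHS]mul1r -(rmorph1 E) -(mulVr x_unit) rmorphM.
by rewrite -mulrA xp -rmorphM pq rmorph1 mulr1.
Qed.

Lemma expandsMX x u : laurent_of_fps u = E (x / eps) -> expands x (u * fps_eps F).
Proof.
move=> ux; rewrite /expands rmorphM [X in _ = X * _]ux.
rewrite [X in _ * X](_ : _ = E eps); last exact/esym/E_spec.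
by rewrite -rmorphM divrK ?eps_unit.
Qed.

Lemma expands_div_eps x p : expands x (p * fps_eps F) -> expands (x / eps) p.
Proof.
move=> xp; rewrite /expands rmorphM xp rmorphM.
rewrite [X in _ * X * _](_ : _ = E eps); last exact/esym/E_spec.
by rewrite -mulrA -rmorphM divrr ?eps_unit // rmorph1 mulr1.
Qed.

(** A quotient of two elements vanishing at [eps = 0] still has a power series
    expansion when the denominator vanishes to order exactly one. *)
Lemma expands_quot x z p q :
    expands x (p * fps_eps F) -> expands z (q * fps_eps F) ->
    fps_coef q 0 \is a GRing.unit ->
  exists q', [/\ expands (x / z) (p * q'), q * q' = 1 & q' * q = 1].
Proof.
move=> /expands_div_eps xp /expands_div_eps zq q0.
have [q' [zq' z_unit qq' q'q]] := expandsV zq q0; exists q'; split=> //.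
suff -> : x / z = (x / eps) * (z / eps)^-1 by apply: expandsM.
by rewrite -{1}[z](divrK eps_unit) invrM ?eps_unit // mulrA.
Qed.

End Expansions.

(** * Reflections and the translation on the skew field K *)

Lemma cyc_nextE m i j : (i < m)%N -> (j < m)%N ->
  cyc_next m i j = (j == i.+1) || ((j == 0%N) && (i.+1 == m)).
Proof.
move=> im jm; rewrite /cyc_next (modn_small jm).
have [im'|] := eqVneq i.+1 m; first by rewrite im' modnn; lia.
by move=> ?; rewrite modn_small; lia.
Qed.

Section Sweep.
Variables (R : realType) (n : nat) (K : unitRingType).
Variable iK : {rmorphism Kalg R n -> K}.
Local Notation l := (ell n).
Local Notation f := (K_f iK).
Local Notation alpha := (K_alpha iK).
Hypothesis n_gt0 : (0 < n)%N.
Hypothesis K_skew : is_skew_field K.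
Variable s : 'I_l.+1 -> {rmorphism K -> K}.
Hypothesis s_spec : forall i, is_reflection_K iK i (s i).

Let l_ge3 : (3 <= l)%N. Proof. rewrite /ell; lia. Qed.

Lemma reflection_f i j : (i <= l)%N -> (j <= l)%N ->
  s (inZp i) (f j) = f j + (alpha i / f i) *~
    (if (j == i.+1) || ((j == 0%N) && (i == l)) then 1
     else if (i == j.+1) || ((i == 0%N) && (j == l)) then -1 else 0).
Proof.
move=> il jl; have [_ _ -> _ _] := s_spec (inZp i).
by rewrite /= (modn_small (m := i)) // /umat !cyc_nextE // !eqSS.
Qed.

Lemma reflection_f_id i j : (i <= l)%N -> (j <= l)%N ->
    [&& j != i.+1, i != j.+1, ~~ ((j == 0%N) && (i == l)) &
        ~~ ((i == 0%N) && (j == l))] ->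
  s (inZp i) (f j) = f j.
Proof. by move=> il jl ij; rewrite reflection_f // !ifN ?addr0 //; lia. Qed.

Lemma reflection_alpha i j : (i <= l)%N -> (j <= l)%N ->
  s (inZp i) (alpha j) = alpha j - alpha i *~
    (if i == j then 2
     else if [|| j == i.+1, (j == 0%N) && (i == l), i == j.+1 |
                 (i == 0%N) && (j == l)] then -1 else 0).
Proof.
move=> il jl; have [_ _ _ -> _] := s_spec (inZp i).
by rewrite /= (modn_small (m := i)) // /cartan !cyc_nextE // !eqSS !modn_small // !orbA.
Qed.

(** Built as a morphism so that it distributes over every field operation. *)
Fixpoint reflections (ks : seq nat) : {rmorphism K -> K} :=
  if ks is k :: ks' then reflections ks' \o s (inZp k) else idfun.

Lemma reflectionsE ks x : foldl (fun y i => s (inZp i) y) x ks = reflections ks x.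
Proof. by elim: ks x => //= k ks IH x. Qed.

Lemma reflections_cat ks ks' x :
  reflections (ks ++ ks') x = reflections ks' (reflections ks x).
Proof. by elim: ks x => //= k ks IH x. Qed.

Lemma reflections_id ks x :
  (forall k, k \in ks -> s (inZp k) x = x) -> reflections ks x = x.
Proof.
elim: ks => //= k ks IH kx; rewrite kx ?mem_head //.
by apply: IH => k' k's; rewrite kx // inE k's orbT.
Qed.

(** The composite of [s_i], ..., [s_l], with [s_i] applied first; the translation is
    [sweep 1] followed by [pi]. *)
Definition sweep (i : nat) : {rmorphism K -> K} := reflections (iota i (l.+1 - i)).

Lemma sweepS i x : (i <= l)%N -> sweep i x = sweep i.+1 (s (inZp i) x).
Proof. by move=> il; rewrite /sweep subSn // subSS. Qed.

(** These two families satisfy a descending recursion in [j], and they express the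
    translation: [swept_alpha j] is the partial sum [alpha j + ... + alpha l], and
    [swept_f j] is a continued fraction in the [f k] with [j <= k]. *)
Definition swept_f (j : nat) : K := sweep j.+1 (f j).
Definition swept_alpha (j : nat) : K := sweep j.+1 (alpha j).

Lemma swept_f_last : swept_f l = f l.
Proof. by rewrite /swept_f /sweep subnn. Qed.

Lemma swept_alpha_last : swept_alpha l = alpha l.
Proof. by rewrite /swept_alpha /sweep subnn. Qed.

Lemma sweep_id_f i j : (0 < j)%N -> (j.+1 < i)%N -> sweep i (f j) = f j.
Proof.
move=> j0 ji; apply: reflections_id => k; rewrite mem_iota => kr.
by apply: reflection_f_id; lia.
Qed.

Lemma sweep_id_alpha i j : (0 < j)%N -> (j.+1 < i)%N -> sweep i (alpha j) = alpha j.
Proof.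
move=> j0 ji; apply: reflections_id => k; rewrite mem_iota => kr.
rewrite reflection_alpha; try lia.
by rewrite !ifN ?subr0 //; lia.
Qed.

Lemma swept_fS j : (0 < j < l)%N ->
  swept_f j = f j - swept_alpha j.+1 / swept_f j.+1.
Proof.
move=> jl; rewrite /swept_f sweepS; last lia.
rewrite reflection_f; try lia.
rewrite ifN ?ifT; try lia.
rewrite rmorphD sweep_id_f; try lia.
by rewrite mulrN1z rmorphN rmorphM skew_rmorphV.
Qed.

Lemma swept_alphaS j : (0 < j < l)%N ->
  swept_alpha j = alpha j + swept_alpha j.+1.
Proof.
move=> jl; rewrite /swept_alpha sweepS; last lia.
rewrite reflection_alpha; try lia.
rewrite ifN ?ifT; try lia.
rewrite rmorphD sweep_id_alpha; try lia.
by rewrite mulrN1z opprK.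
Qed.

(** The reflections [s_1], ..., [s_(j-1)] do not move [f j.+1], then [s_j] adds
    [alpha j / f j] to it, and [s_(j+1)] fixes the generator [f j.+1] again; what is left
    of the sweep turns each of the three ingredients into its swept version. *)
Lemma T1_K_f (pi : {rmorphism K -> K}) j : (0 < j < l)%N ->
  T1_K s pi (f j.+1) = pi (swept_f j.+1 + swept_alpha j / swept_f j).
Proof.
move=> jl; rewrite /T1_K reflectionsE; congr (pi _).
have -> : iota 1 l = iota 1 j.-1 ++ iota j (l.+1 - j).
  have -> : iota j (l.+1 - j) = iota (1 + j.-1) (l.+1 - j) by congr iota; lia.
  by rewrite -iotaD; congr iota; lia.
rewrite reflections_cat [reflections (iota 1 _) _]reflections_id; last first.
  by move=> k; rewrite mem_iota => kr; apply: reflection_f_id; lia.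
rewrite -/(sweep j) sweepS; last lia.
rewrite reflection_f; try lia.
rewrite ifT; try lia.
rewrite mulr1z rmorphD rmorphM skew_rmorphV //; congr (_ + _).
by rewrite sweepS ?reflection_f_id //; lia.
Qed.

(** The composite [s_0 s_1 s_0] is the reflection in the root [alpha 0 + alpha 1]. *)
Section FirstReflection.
Local Notation z := (f 1%N + alpha 0%N / f 0%N).

Let s0f0 : s (inZp 0) (f 0%N) = f 0%N. Proof. by apply: reflection_f_id; lia. Qed.

Let s0f1 : s (inZp 0) (f 1%N) = z. Proof. by rewrite reflection_f. Qed.

Let s0a1 : s (inZp 0) (alpha 1%N) = alpha 1%N + alpha 0%N.
Proof. by rewrite reflection_alpha //= mulrN1z opprK. Qed.

Let s0a0 : s (inZp 0) (alpha 0%N) = - alpha 0%N.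
Proof.
rewrite reflection_alpha //= (_ : _ *~ 2 = alpha 0%N + alpha 0%N).
  by rewrite opprD addNKr.
exact: mulr2n.
Qed.

Lemma r_K0_f2 : r_K s 0 (f 2) = f 2 + (alpha 1%N + alpha 0%N) / z.
Proof.
rewrite /r_K eqxx [s _ (f 2)]reflection_f_id //; try lia.
rewrite reflection_f //; last lia.
rewrite /= mulr1z rmorphD rmorphM skew_rmorphV // s0a1 s0f1.
by rewrite reflection_f_id //; lia.
Qed.

Lemma r_K0_fl : r_K s 0 (f l) =
  f l - alpha 0%N / f 0%N - alpha 1%N / (f 0%N - (alpha 1%N + alpha 0%N) / z).
Proof.
have s0fl : s (inZp 0) (f l) = f l - alpha 0%N / f 0%N.
  by rewrite reflection_f // ifN ?ifT ?mulrN1z //; lia.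
have s1fl : s (inZp 1) (f l) = f l by apply: reflection_f_id; lia.
have s1a0 : s (inZp 1) (alpha 0%N) = alpha 0%N + alpha 1%N.
  by rewrite reflection_alpha //= ifT ?mulrN1z ?opprK //; lia.
have s1f0 : s (inZp 1) (f 0%N) = f 0%N - alpha 1%N / f 1%N.
  by rewrite reflection_f // ifN ?ifT ?mulrN1z //; lia.
rewrite /r_K eqxx s0fl rmorphB rmorphM skew_rmorphV // s1fl s1a0 s1f0.
rewrite rmorphB rmorphM rmorphD skew_rmorphV // rmorphB rmorphM skew_rmorphV //.
by rewrite s0fl s0f0 s0a0 s0a1 s0f1 (addrC (alpha 1%N)) addKr.
Qed.

Lemma r_K0_f j : (2 < j < l)%N -> r_K s 0 (f j) = f j.
Proof. by move=> jl; rewrite /r_K eqxx !reflection_f_id //; lia. Qed.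

End FirstReflection.

Lemma r_K_f i j : (0 < i < l)%N -> (0 < j < l)%N ->
  r_K s i (f j.+1) = f j.+1 + (alpha i.+1 / f i.+1) *~ umat l i j.
Proof.
move=> il jl; rewrite /r_K ifN; last lia.
rewrite reflection_f //; try lia.
rewrite /umat !cyc_nextE; try lia.
by congr (_ + _ *~ (if _ then _ else if _ then _ else _)); lia.
Qed.

End Sweep.

(** * Sums over periodic sequences *)

Lemma sum_pairs (V : nmodType) (g : nat -> V) (n : nat) :
  \sum_(1 <= k < (2 * n).+1) g k =
  \sum_(1 <= k < n.+1) g (2 * k - 1)%N + \sum_(1 <= k < n.+1) g (2 * k)%N.
Proof.
elim: n => [|n IH]; first by rewrite !big_geq ?addr0.
rewrite !(big_nat_recr n.+1) //= addrACA -IH mulnS !addSn add0n.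
by rewrite big_nat_recr //= big_nat_recr //= -addrA subn1.
Qed.

Section PeriodicSequence.
Variable n : nat.
Local Notation l := (ell n).

(** Both sums of the differential equation are of this form: the subtracted one,
    [\sum g (i + 2 * k)], is the value at [i.+1]. As the period is odd, the two of them
    split the cycle with [i] removed into the indices at odd and at even distance. *)
Definition odd_sum (V : nmodType) (g : nat -> V) (i : nat) : V :=
  \sum_(1 <= k < n.+1) g (i + 2 * k - 1)%N.

Lemma odd_sumS (V : nmodType) (g : nat -> V) i :
  odd_sum g i.+1 = \sum_(1 <= k < n.+1) g (i + 2 * k)%N.
Proof. by apply: eq_big_nat => k _; congr g; lia. Qed.

Lemma periodic_modn (T : Type) (g : nat -> T) :
  (forall i, g (i + l)%N = g i) -> forall i j, i = j %[mod l] -> g i = g j.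
Proof.
move=> gP; have gM i : g i = g (i %% l)%N.
  rewrite {1}(divn_eq i l) addnC; elim: (i %/ l)%N => [|q IH]; first by rewrite addn0.
  by rewrite mulSnr addnA gP.
by move=> i j ij; rewrite gM ij -gM.
Qed.

Section Additive.
Variables (V : nmodType) (g : nat -> V).
Hypothesis gP : forall i, g (i + l)%N = g i.

Lemma periodic_sum i : \sum_(0 <= k < l) g (i + k)%N = \sum_(0 <= k < l) g k.
Proof.
elim: i => // i <-; rewrite [RHS]big_nat_recl // addn0 addrC -(gP i) big_nat_recr //=.
by congr (_ + _); [apply: eq_bigr => k _|]; rewrite addSnnS.
Qed.

(** The relation from which everything about [odd_sum] follows: together with [g i], the
    two sums exhaust the cycle. *)
Lemma odd_sumD i : odd_sum g i + odd_sum g i.+1 + g i = \sum_(0 <= k < l) g k.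
Proof.
rewrite -(periodic_sum i) big_ltn // addn0 addrC (sum_pairs (fun k => g (i + k)%N)).
rewrite odd_sumS; congr (_ + (_ + _)).
by apply: eq_big_nat => k kr; congr g; lia.
Qed.

Lemma odd_sum_periodic i : odd_sum g (i + l) = odd_sum g i.
Proof. by apply: eq_big_nat => k kr; rewrite -[RHS]gP; congr g; lia. Qed.

End Additive.

(** The ordered pairs at odd distance [2 k - 1] are, read backwards along the cycle, those
    at even distance [l - (2 k - 1) = 2 (n - k + 1)]. *)
Lemma sum_mul_odd_sum (A : pzRingType) (g : nat -> A) :
  (forall i, g (i + l)%N = g i) ->
  \sum_(0 <= i < l) g i * odd_sum g i = \sum_(0 <= i < l) odd_sum g i.+1 * g i.
Proof.
move=> gP; under eq_bigr do rewrite mulr_sumr.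
under [RHS]eq_bigr do rewrite odd_sumS mulr_suml.
rewrite !(exchange_big_nat _ 0 l) /= big_nat_rev /=.
apply: eq_big_nat => k kr.
rewrite -(@periodic_sum _ (fun i => g (i + 2 * k)%N * g i) _ (l - 2 * k)).
  by apply: eq_bigr => i _; rewrite -(gP i); congr (g _ * g _); rewrite /ell; lia.
by move=> i; rewrite addnAC !gP.
Qed.

End PeriodicSequence.

(** The entries are read off relative to the row index, [j = i + m] with [m < l], so that
    no case distinction on wrapping around the cycle is needed. *)
Section CyclicMatrices.
Variable l : nat.
Hypothesis l_ge3 : (3 <= l)%N.

Let cyc_nextl i m : (m < l)%N -> cyc_next l i (i + m) = (m == 1%N).
Proof. by move=> ml; rewrite /cyc_next -addn1 eqn_modDl !modn_small //; lia. Qed.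

Let cyc_nextr i m : (m < l)%N -> cyc_next l (i + m) i = (m == l.-1).
Proof.
move=> ml; rewrite /cyc_next -{1}(addn0 i) -addnS eqn_modDl mod0n.
have [e|ne] := eqVneq m.+1 l; first by rewrite e modnn; lia.
by rewrite modn_small; lia.
Qed.

Lemma umatE i m : (m < l)%N ->
  umat l i (i + m) = if m == 1%N then 1 else if m == l.-1 then -1 else 0.
Proof. by move=> ml; rewrite /umat cyc_nextl // cyc_nextr. Qed.

Lemma cartanE i m : (m < l)%N ->
  cartan l i (i + m) =
    if m == 0%N then 2 else if (m == 1%N) || (m == l.-1) then -1 else 0.
Proof.
move=> ml; rewrite /cartan cyc_nextl // cyc_nextr // -{1}(addn0 i) eqn_modDl mod0n.
by rewrite modn_small // eq_sym.
Qed.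

Lemma modn_shift i j : (i < l)%N -> exists2 m, (m < l)%N & j = i + m %[mod l].
Proof.
move=> il; exists ((j + (l - i)) %% l)%N; first by rewrite ltn_mod; lia.
by rewrite modnDmr addnCA subnKC ?modnDr // ltnW.
Qed.

Lemma umat_periodic i j : umat l i (j + l) = umat l i j.
Proof. by rewrite /umat /cyc_next -addSn !modnDr. Qed.

Lemma cartan_periodic i j : cartan l i (j + l) = cartan l i j.
Proof. by rewrite /cartan /cyc_next -addSn !modnDr. Qed.

Lemma sum_umat (V : zmodType) (w : V) i : \sum_(0 <= m < l) w *~ umat l i (i + m) = 0.
Proof.
have [k lE] : exists k, l = k.+3 by exists (l - 3)%N; lia.
rewrite [in index_iota 0 _]lE big_nat_recr //= big_ltn // big_ltn // !umatE; try lia.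
rewrite big_nat big1 => [|m mr].
  by rewrite lE /= eqxx mulr0z mulrN1z add0r addr0 subrr.
by rewrite umatE ?ifN ?mulr0z //; lia.
Qed.

End CyclicMatrices.

(** * Commutation of a reflection with the derivation on the dependent variables *)

(** Only the shape of the derivation and of the reflection enters here: the argument is a
    computation with the relation [S j + S j.+1 + psi j = t]. *)
Section Backlund.
Variables (n : nat) (F : unitRingType).
Hypothesis n_gt0 : (0 < n)%N.
Local Notation l := (ell n).
Variables (psi gamma : nat -> F) (t : F) (delta : F -> F).
Hypothesis psiP : forall j, psi (j + l)%N = psi j.
Hypothesis gamma_central : forall j x, gamma j * x = x * gamma j.
Hypothesis psi_sum : \sum_(0 <= j < l) psi j = t.
Hypothesis deltaD : forall x y, delta (x + y) = delta x + delta y.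
Hypothesis deltaM : forall x y, delta (x * y) = delta x * y + x * delta y.
Hypothesis delta_gamma : forall j, delta (gamma j) = 0.
Local Notation S := (odd_sum n psi).
Hypothesis delta_psi :
  forall j, delta (psi j) = psi j * S j - S j.+1 * psi j + gamma j.
Variables (i : nat) (rho : {rmorphism F -> F}).
Hypothesis i_lt : (i < l)%N.
Hypothesis psi_unit : psi i \is a GRing.unit.
Hypothesis rho_t : rho t = t.
Variable w : F.
Hypothesis wx : w * psi i = gamma i.
Hypothesis rho_psi : forall j, rho (psi j) = psi j + w *~ umat l i j.
Hypothesis rho_gamma :
  forall j, rho (gamma j) = gamma j - gamma i *~ cartan l i j.

Let l_ge3 : (3 <= l)%N. Proof. rewrite /ell; lia. Qed.

Let SD j : S j + S j.+1 + psi j = t.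
Proof. by rewrite odd_sumD. Qed.

Let SS j : S j.+1 = t - psi j - S j.
Proof. by rewrite -(SD j) addrK addrAC subrr add0r. Qed.

Let S_step j : S j + psi j = psi j.+1 + S j.+2.
Proof.
apply: (addrI (S j.+1)); rewrite addrA (addrC _ (S j)) SD.
by rewrite (addrC (psi _)) addrA SD.
Qed.

Let xw : psi i * w = gamma i.
Proof. by rewrite -[w](mulrK psi_unit) wx gamma_central mulVKr. Qed.

(** The correction [w] only affects the two sums [S i] and [S i.+1], because the
    relation [S j + S j.+1 + psi j = t] propagates it with alternating signs. *)
Lemma rho_odd_sum m : (m < l)%N ->
  rho (S (i + m)) =
  S (i + m) + (if m == 0%N then w else if m == 1%N then - w else 0).
Proof.
elim: m => [_|m IH ml].
  (* Among the indices [i + 1], [i + 3], ..., [i + 2 n - 1], only [i + 1] is a neighbour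
     of [i]. *)
  rewrite addn0 /odd_sum rmorph_sum /=.
  have term k : (1 <= k < n.+1)%N ->
      rho (psi (i + 2 * k - 1)%N) =
      psi (i + 2 * k - 1)%N + (if k == 1%N then w else 0).
    move=> kr; rewrite rho_psi -addnBA; last lia.
    rewrite umatE; [|rewrite /ell; lia ..].
    have -> : (2 * k - 1 == 1)%N = (k == 1%N) by lia.
    have -> : (2 * k - 1 == l.-1)%N = false by rewrite /ell; lia.
    by case: eqP => _; rewrite ?mulr1z ?mulr0z.
  rewrite (eq_big_nat _ _ term) big_split /=; congr (_ + _).
  rewrite big_ltn // big_nat big1 ?addr0 // => k kr.
  by case: eqP => // k1; lia.
rewrite addnS SS !rmorphB rho_t IH; last lia.
rewrite rho_psi umatE; [|lia ..].
rewrite (_ : m.+1 == 0%N = false) // eqSS.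
have [-> | m0] := eqVneq m 0%N.
  by rewrite ifN ?ifN ?mulr0z ?addr0 //; [rewrite opprD addrA | lia].
have [-> | m1] := eqVneq m 1%N.
  by rewrite mulr1z addr0 opprD opprB addrA addrA subrK.
by rewrite ifN ?mulr0z ?addr0 //; lia.
Qed.

Let delta0 : delta 0 = 0.
Proof. by apply: (addrI (delta 0)); rewrite -deltaD !addr0. Qed.

Let deltaN x : delta (- x) = - delta x.
Proof. by apply/eqP; rewrite -addr_eq0 -deltaD addNr delta0. Qed.

(** Differentiate [w * psi i = gamma i], whose right-hand side is a constant. *)
Lemma delta_w : delta w = w * S i.+1 - S i * w - w * w.
Proof.
have : delta w * psi i + w * delta (psi i) = 0 by rewrite -deltaM wx delta_gamma.
move/eqP; rewrite addr_eq0 => /eqP dw.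
apply: (mulIr psi_unit); rewrite dw delta_psi !mulrBl -(mulrA _ w) -mulrA wx.
rewrite mulrDr mulrBr !mulrA wx gamma_central !opprD opprK.
by rewrite (addrC (- _)) -(mulrA w w) wx.
Qed.

(** The neighbours [i - 1] and [i + 1] are where [delta w] enters, and there the
    identity reduces to [S_step]; at [i] itself the contributions [w * psi i] and
    [psi i * w], both equal to [gamma i], make up for the change of sign of [gamma i]. *)
Lemma rho_delta_psi j : rho (delta (psi j)) = delta (rho (psi j)).
Proof.
have [m ml jm] := modn_shift l_ge3 j i_lt.
rewrite (periodic_modn psiP jm) {j jm}.
rewrite delta_psi rho_psi deltaD delta_psi rmorphD rmorphB !rmorphM.
rewrite rho_gamma rho_psi umatE // cartanE //.
have deltaw0 : delta (w *~ 0) = 0 by rewrite mulr0z delta0.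
have [m_last|m_not_last] := eqVneq m l.-1.
  have iS : (i + m).+1 = (i + l)%N by lia.
  have SiS : S (i + m).+1 = S i by rewrite iS odd_sum_periodic.
  have := S_step (i + m); rewrite SiS.
  have -> : psi (i + m).+1 = psi i by rewrite iS.
  have -> : S (i + m).+2 = S i.+1 by rewrite iS -addSn odd_sum_periodic.
  rewrite rho_odd_sum // => stp.
  have := rho_odd_sum (_ : 0 < l)%N; rewrite addn0 => -> //.
  have [-> ->] : (m == 0%N) = false /\ (m == 1%N) = false by lia.
  have SE : S i.+1 = S (i + m) + psi (i + m) - psi i by rewrite stp addrC addKr.
  by rewrite !mulrN1z deltaN delta_w SE -wx /=; noncomm.
rewrite -addnS !rho_odd_sum; [|lia ..].
have [m0|m0] := eqVneq m 0%N.
  rewrite m0 addn0 addn1.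
  have -> : gamma i *~ 2 = gamma i + gamma i by exact: mulr2n.
  rewrite /= !mulr0z delta0 !addr0 mulrDr xw mulrBl wx; noncomm.
have [m1|m1] := eqVneq m 1%N.
  have := S_step i; rewrite m1 addn1 addn2 => stp.
  have SE : S i = psi i.+1 + S i.+2 - psi i by rewrite -stp addrK.
  rewrite /= !mulr1z mulrN1z delta_w -[in gamma i]xw [in S i * w]SE; noncomm.
by rewrite !ifN ?deltaw0 ?mulr0z ?subr0 ?addr0 //; lia.
Qed.
End Backlund.

(** * Relations in the skew field F *)

Lemma inZp_modn (p i j : nat) : i = j %[mod p.+1] -> inZp i = inZp j :> 'I_p.+1.
Proof. by move=> ij; apply: val_inj. Qed.

Lemma K_f_modn (R : realType) n (K : unitRingType) (iK : {rmorphism Kalg R n -> K}) i j :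
  i = j %[mod (ell n).+1] -> K_f iK i = K_f iK j.
Proof. by move=> ij; rewrite /K_f (inZp_modn ij). Qed.

Lemma K_alpha_modn (R : realType) n (K : unitRingType)
    (iK : {rmorphism Kalg R n -> K}) i j :
  i = j %[mod (ell n).+1] -> K_alpha iK i = K_alpha iK j.
Proof. by move=> ij; rewrite /K_alpha (inZp_modn ij). Qed.

Section FieldF.
Variables (R : realType) (n : nat).
Hypothesis n_gt0 : (0 < n)%N.
Variables (F : unitRingType) (iF : {rmorphism Falg R n -> F}).
Hypothesis F_quotient : is_quotient_skew_field iF.
Local Notation l := (ell n).
Local Notation phi := (F_phi iF).
Local Notation beta := (F_beta iF).
Local Notation t := (F_t iF).
Local Notation psi := (F_psi iF).
Local Notation gamma := (F_gamma iF).

Lemma Frel_eq0 x : Frel x -> iF (quot_pi (@Frel R n) x) = 0.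
Proof.
move=> rel_x; rewrite (_ : quot_pi _ x = 0) ?rmorph0 //.
rewrite -(rmorph0 (quot_pi (@Frel R n))); apply/quot_piP.
by rewrite subr0; apply: ideal_gen_in.
Qed.

Lemma F_central (c : free_alg (complex R) (Fgen n)) :
    (forall g, Frel (commutator c (free_gen _ g))) ->
  forall x, GRing.comm (iF (quot_pi _ c)) x.
Proof.
move=> c_gen; apply: (quotient_skew_field_ind F_quotient).
- move=> a; rewrite /GRing.comm /presented_scalar -!rmorphM.
  by rewrite free_alg_scalar_central.
- move=> g; apply/eqP; rewrite -subr_eq0 -!rmorphM -!rmorphB.
  by apply/eqP/Frel_eq0/c_gen.
- by move=> x y; apply: commrD.
- by move=> x y; apply: commrM.
- by move=> x _; apply: commrV.
Qed.

Lemma F_t_central x : t * x = x * t.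
Proof. by apply: F_central => g; apply: Frel_t. Qed.

Lemma F_beta_central i x : beta i * x = x * beta i.
Proof. by apply: F_central => g; apply: Frel_beta. Qed.

Lemma F_phi_even : \sum_(0 <= k < n.+1) phi (2 * k)%N = 0.
Proof. by have := Frel_eq0 (Frel_phi_even R n); rewrite !rmorph_sum. Qed.

Lemma F_phi_odd : \sum_(0 <= k < n.+1) phi (2 * k).+1 = 0.
Proof. by have := Frel_eq0 (Frel_phi_odd R n); rewrite !rmorph_sum. Qed.

Lemma F_beta_sum : \sum_(0 <= k < l.+1) beta k = 1.
Proof.
have := Frel_eq0 (Frel_beta_sum R n).
by rewrite !rmorphB !rmorph1 !rmorph_sum => /subr0_eq.
Qed.

Lemma F_psiP i : psi (i + l)%N = psi i.
Proof. by rewrite /F_psi modnDr. Qed.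

Lemma F_gammaP i : gamma (i + l)%N = gamma i.
Proof. by rewrite /F_gamma modnDr. Qed.

Lemma F_psiE i : (0 < i < l)%N -> psi i = phi i.+1.
Proof. by case: i => // i il; rewrite /F_psi modn_small. Qed.

Lemma F_gammaE i : (0 < i < l)%N -> gamma i = beta i.+1.
Proof. by case: i => // i il; rewrite /F_gamma modn_small. Qed.

Lemma F_psi0 : psi 0%N = phi 0%N + phi 1%N + t.
Proof. by rewrite /F_psi mod0n. Qed.

Lemma F_gamma0 : gamma 0%N = beta 0%N + beta 1%N.
Proof. by rewrite /F_gamma mod0n. Qed.

Lemma F_gamma_central i x : gamma i * x = x * gamma i.
Proof.
rewrite /F_gamma; case: (i %% _)%N => [|j]; last exact: F_beta_central.
by rewrite mulrDl mulrDr !F_beta_central.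
Qed.

Lemma F_phi0 : phi 0%N = - \sum_(1 <= k < n.+1) phi (2 * k)%N.
Proof. by apply/eqP; rewrite -addr_eq0; apply/eqP; rewrite -[RHS]F_phi_even [RHS]big_ltn. Qed.

Lemma F_phi1 : phi 1%N = - \sum_(1 <= k < n.+1) phi (2 * k).+1.
Proof. by apply/eqP; rewrite -addr_eq0; apply/eqP; rewrite -[RHS]F_phi_odd [RHS]big_ltn. Qed.

Lemma sum_odd_psi : \sum_(1 <= k < n.+1) psi (2 * k - 1)%N = - phi 0%N.
Proof.
rewrite F_phi0 opprK; apply: eq_big_nat => k kr.
by rewrite F_psiE; [congr phi|]; rewrite /ell; lia.
Qed.

Lemma sum_even_psi : \sum_(1 <= k < n.+1) psi (2 * k)%N = - phi 1%N.
Proof.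
rewrite F_phi1 opprK; apply: eq_big_nat => k kr.
by rewrite F_psiE // /ell; lia.
Qed.

Lemma F_psi_sum : \sum_(0 <= j < l) psi j = t.
Proof.
rewrite big_ltn // (sum_pairs psi) sum_odd_psi sum_even_psi F_psi0.
noncomm.
Qed.

Lemma odd_sum_psi_last : odd_sum n psi l = - phi 0%N.
Proof.
rewrite -sum_odd_psi; apply: eq_big_nat => k kr.
by rewrite -[RHS]F_psiP; congr psi; lia.
Qed.

Lemma F_gamma_sum : \sum_(0 <= j < l) gamma j = 1.
Proof.
rewrite -F_beta_sum big_ltn // [RHS]big_ltn // [in RHS]big_ltn // F_gamma0 -addrA.
congr (_ + (_ + _)); rewrite [RHS]big_add1; apply: eq_big_nat => j jr.
by rewrite F_gammaE.
Qed.

(** The two sum relations express [phi 0] and [phi 1] by the other [phi i], which are the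
    [psi i] with [0 < i]; these are also the ones whose images the two actions specify. *)
Lemma F_ind (P : F -> Prop) :
  (forall c, P (F_scalar iF c)) -> (forall i, (0 < i < l)%N -> P (psi i)) ->
  (forall i, (i <= l)%N -> P (beta i)) -> P t -> P (F_h iF) ->
  (forall x y, P x -> P y -> P (x + y)) ->
  (forall x y, P x -> P y -> P (x * y)) ->
  (forall x, x \is a GRing.unit -> P x -> P x^-1) -> forall x, P x.
Proof.
move=> Pc Ppsi Pbeta Pt Ph PD PM PV.
have P0 : P 0 by have := Pc 0; rewrite /F_scalar /presented_scalar scale0r !rmorph0.
have PN x : P x -> P (- x).
  move=> Px; rewrite -mulN1r; apply: PM => //.
  by have := Pc (-1); rewrite /F_scalar /presented_scalar scaleN1r !(rmorphN1, rmorph1).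
have Psum (g : nat -> F) : (forall k, (1 <= k < n.+1)%N -> P (g k)) ->
    P (- \sum_(1 <= k < n.+1) g k).
  by move=> Pg; apply: PN; rewrite big_nat; apply: (big_ind P).
have Pphi k : (2 <= k <= l)%N -> P (phi k).
  by case: k => // k kr; rewrite -F_psiE; [apply: Ppsi|]; lia.
apply: (quotient_skew_field_ind F_quotient) => //; case=> [i|i||] //.
- rewrite -(valZpK i); have := ltn_ord i; move: (i : nat) => {}i il.
  rewrite -/(phi i).
  case: i il => [|[|i]] il.
  + by rewrite F_phi0; apply: Psum => k kr; apply: Pphi; rewrite /ell; lia.
  + by rewrite F_phi1; apply: Psum => k kr; apply: Pphi; rewrite /ell; lia.
  + by apply: Pphi; lia.
- by rewrite -(valZpK i); apply: Pbeta; rewrite -ltnS.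
Qed.

End FieldF.

(** * Expansion of the translation and the derivation *)

Section Degeneration.
Variables (R : realType) (n : nat).
Hypothesis n_gt0 : (0 < n)%N.
Variables (K : unitRingType) (iK : {rmorphism Kalg R n -> K}).
Hypothesis K_quotient : is_quotient_skew_field iK.
Variable s : 'I_(ell n).+1 -> {rmorphism K -> K}.
Hypothesis s_spec : forall i, is_reflection_K iK i (s i).
Variables (F : unitRingType) (iF : {rmorphism Falg R n -> F}).
Hypothesis F_quotient : is_quotient_skew_field iF.
Variables (Fe : unitRingType) (iFe : {rmorphism {poly F} -> Fe}).
Hypothesis Fe_quotient : is_quotient_skew_field iFe.
Variable Psi : {rmorphism K -> Fe}.
Hypothesis Psi_spec : is_Psi iF iFe iK Psi.
Variable E : {rmorphism Fe -> laurent F}.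
Hypothesis E_spec : is_expansion iFe E.

Local Notation l := (ell n).
Local Notation f := (K_f iK).
Local Notation alpha := (K_alpha iK).
Local Notation phi := (F_phi iF).
Local Notation beta := (F_beta iF).
Local Notation t := (F_t iF).
Local Notation psi := (F_psi iF).
Local Notation gamma := (F_gamma iF).
Local Notation eps := (fps_eps F).
Local Notation S := (odd_sum n psi).
Local Notation expands := (expands E).
Local Notation expands_Psi x p := (expands (Psi x) p).

Let K_skew : is_skew_field K. Proof. by case: K_quotient. Qed.
Let Fe_skew : is_skew_field Fe. Proof. by case: Fe_quotient. Qed.
Let iFe_inj : injective iFe. Proof. by case: Fe_quotient. Qed.
Let eC x : expands (iFe x%:P) (fpsC x). Proof. exact: expandsC E_spec x. Qed.
Let eX : expands (iFe 'X) eps. Proof. exact: expandsX E_spec. Qed.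
Let e1 : expands 1 1. Proof. exact: expands1. Qed.

Lemma expands_f0 : expands_Psi (f 0%N) (1 + eps * fpsC (phi 0%N)).
Proof. by case: Psi_spec => _ [-> _ _] _ _; apply/expandsD/expandsM. Qed.

Lemma expands_f1 : expands_Psi (f 1%N) (1 + eps * fpsC (phi 1%N)).
Proof. by case: Psi_spec => _ [_ -> _] _ _; apply/expandsD/expandsM. Qed.

Lemma expands_f i : (2 <= i <= l)%N -> expands_Psi (f i) (eps * fpsC (phi i)).
Proof. by move=> il; case: Psi_spec => _ [_ _ ->] // _ _; apply: expandsM. Qed.

Let eX2 : expands (iFe 'X ^+ 2) (eps * eps).
Proof. by rewrite expr2; apply: expandsM. Qed.

Lemma expands_alpha0 : expands_Psi (alpha 0%N)
  (-1 + eps * fpsC t + eps * eps * fpsC (beta 0%N)).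
Proof.
case: Psi_spec => _ _ [-> _ _] _.
by apply: expandsD (expandsD (expandsN e1) (expandsM eX (eC _))) (expandsM eX2 (eC _)).
Qed.

Lemma expands_alpha1 : expands_Psi (alpha 1%N)
  (1 - eps * fpsC t + eps * eps * fpsC (beta 1%N)).
Proof.
case: Psi_spec => _ _ [_ -> _] _.
by apply: expandsD (expandsB e1 (expandsM eX (eC _))) (expandsM eX2 (eC _)).
Qed.

Lemma expands_alpha i : (2 <= i <= l)%N ->
  expands_Psi (alpha i) (eps * eps * fpsC (beta i)).
Proof.
move=> il; case: Psi_spec => _ _ [_ _ ->] // _; exact: expandsM eX2 (eC _).
Qed.

(** The witnesses are hidden on purpose, so that later computations only see the
    coefficients. *)
Lemma expands_f01 i : (i < 2)%N -> exists p,
  [/\ expands_Psi (f i) p, fps_coef p 0 = 1 & fps_coef p 1 = phi i].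
Proof.
move=> i2; exists (1 + eps * fpsC (phi i)); split.
- by case: i i2 => [|[|//]] _; [exact: expands_f0 | exact: expands_f1].
- by rewrite fps_coefD fps_coefXM fps_coef1 addr0.
- by rewrite fps_coefD fps_coefXM fps_coef1 fps_coefC add0r.
Qed.

Lemma expands_alpha01 : exists a b,
  [/\ expands_Psi (alpha 0%N) a, expands_Psi (alpha 1%N) b,
      b + a = eps * fpsC (gamma 0) * eps
    & [/\ fps_coef a 0 = -1, fps_coef a 1 = t, fps_coef b 0 = 1 & fps_coef b 1 = - t]].
Proof.
exists (-1 + eps * fpsC t + eps * eps * fpsC (beta 0%N)).
exists (1 - eps * fpsC t + eps * eps * fpsC (beta 1%N)).
split; [exact: expands_alpha0 | exact: expands_alpha1 | |].
  have -> : fpsC (gamma 0%N) = fpsC (beta 0%N) + fpsC (beta 1%N).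
    by rewrite F_gamma0; exact: rmorphD.
  rewrite -[RHS]mulrA [(_ + _) * eps]fps_commX [RHS]mulrA [RHS]mulrDr.
  move: (eps * fpsC t) (eps * eps * fpsC (beta 0%N)) (eps * eps * fpsC (beta 1%N)).
  by move=> x y z; noncomm.
have c2 c k : (k < 2)%N -> fps_coef (eps * eps * fpsC c) k = 0.
  by case: k => [|[|//]] _; rewrite -mulrA !fps_coefXM.
split; rewrite (fps_coefD (_ + _)) c2 // addr0 fps_coefD ?fps_coefN fps_coefXM;
  by rewrite fps_coef1 ?fps_coefC /= ?(mulr0n, oppr0, addr0, add0r).
Qed.

Section Translation.
Variable pi : {rmorphism K -> K}.
Hypothesis pi_spec : is_rotation_K iK pi.

(** The expansion of [alpha i.+1 + ... + alpha l + alpha 0] under [Psi], which is the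
    image under [pi] of [swept_alpha i]. *)
Definition swept_alpha_series (i : nat) : fps F :=
  -1 + eps * fpsC t + eps * eps * fpsC (beta 0%N + \sum_(i.+1 <= k < l.+1) beta k).
Local Notation b := swept_alpha_series.

Lemma expands_swept_alpha i : (0 < i <= l)%N ->
  expands_Psi (pi (swept_alpha iK s i)) (b i).
Proof.
have [_ _ _ pi_alpha _] := pi_spec.
move=> il; rewrite (_ : i = l - (l - i))%N; last lia.
have : (l - i < l)%N by lia.
elim: (l - i)%N => {i il} [_|m IH ml].
  rewrite subn0 swept_alpha_last pi_alpha (@K_alpha_modn _ _ _ _ _ 0) ?modnn //.
  by rewrite /b big_geq // addr0; apply: expands_alpha0.
have [i iE] : exists i, (l - m = i.+1)%N by exists (l - m.+1)%N; lia.
have -> : (l - m.+1 = i)%N by lia.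
rewrite swept_alphaS //; last lia.
rewrite !rmorphD pi_alpha -iE.
have -> : b i = eps * eps * fpsC (beta i.+1) + b (l - m).
  rewrite /b iE big_ltn; last lia.
  by rewrite (addrCA (beta 0%N)) rmorphD mulrDr addrCA.
apply: expandsD; last by apply: IH; lia.
by rewrite iE; apply: expands_alpha; lia.
Qed.

Lemma swept_alpha_series_coef i :
  [/\ fps_coef (b i) 0 = -1, fps_coef (b i) 1 = t
    & fps_coef (b i) 2 = beta 0%N + \sum_(i.+1 <= k < l.+1) beta k].
Proof.
rewrite /b -mulrA -!fps_commX !fps_coefD !fps_coefMX !fps_coefN !fps_coef1 !fps_coefC.
by rewrite /= oppr0 !addr0 !add0r.
Qed.

(** One step of the continued fraction. The product form of the recursion is kept because
    it gives access to the coefficients of [eps^2] without inverting [q] to that order. *)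
Lemma expands_swept_f_step i q : (0 < i < l)%N ->
  expands_Psi (pi (swept_f iK s i.+1)) q -> fps_coef q 0 = 1 ->
  exists p, [/\ expands_Psi (pi (swept_f iK s i)) p,
    p * q = eps * fpsC (phi i.+1) * q - b i.+1,
    fps_coef p 0 = 1 & fps_coef p 1 = phi i.+1 - t - fps_coef q 1].
Proof.
have [_ _ pi_f _ _] := pi_spec.
move=> il qE q0.
have q0_unit : fps_coef q 0 \is a GRing.unit by rewrite q0 unitr1.
have [q' [q'E _ qq' q'q]] := expandsV Fe_skew qE q0_unit.
have [q'0 q'1] := fps_inv_coef qq' q0.
have [b0 b1 _] := swept_alpha_series_coef i.+1.
exists (eps * fpsC (phi i.+1) - b i.+1 * q'); split.
- rewrite swept_fS // !rmorphB !rmorphM !skew_rmorphV //.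
  rewrite pi_f; apply: expandsB; first by apply: expands_f; lia.
  by apply: expandsM => //; apply: expands_swept_alpha; lia.
- by rewrite mulrBl -!mulrA q'q mulr1.
- by rewrite -fps_commX fps_coefD fps_coefMX fps_coefN fps_coefM0 b0 q'0; noncomm.
rewrite -fps_commX fps_coefD fps_coefMX fps_coefC fps_coefN fps_coefM1 b0 b1 q'0 q'1 /=.
noncomm.
Qed.

(** All the continued fractions start with [1], since numerator and denominator are [1]
    and [-1] at [eps = 0]; their linear terms obey the recursion of [odd_sumD], starting
    from [phi 0 = - S l]. *)
Lemma expands_swept_f i : (0 < i <= l)%N -> exists p,
  [/\ expands_Psi (pi (swept_f iK s i)) p, fps_coef p 0 = 1 & fps_coef p 1 = - S i].
Proof.
have [_ _ pi_f _ _] := pi_spec.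
move=> il; rewrite (_ : i = l - (l - i))%N; last lia.
have : (l - i < l)%N by lia.
elim: (l - i)%N => {i il} [_|m IH ml].
  exists (1 + eps * fpsC (phi 0%N)); split.
  - rewrite subn0 swept_f_last pi_f (@K_f_modn _ _ _ _ _ 0) ?modnn //.
    exact: expands_f0.
  - by rewrite -fps_commX fps_coefD fps_coefMX fps_coef1 addr0.
  - rewrite -fps_commX fps_coefD fps_coefMX fps_coef1 fps_coefC add0r subn0.
    by rewrite odd_sum_psi_last // opprK.
have [i iE] : exists i, (l - m = i.+1)%N by exists (l - m.+1)%N; lia.
have -> : (l - m.+1 = i)%N by lia.
have [|q [qE q0 q1]] := IH; first lia.
rewrite iE in qE q1.
have [|p [pE _ p0 p1]] := expands_swept_f_step _ qE q0; first lia.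
exists p; split=> //; rewrite p1 q1 -F_psiE; last lia.
have <- : S i + S i.+1 + psi i = t.
  by rewrite odd_sumD; [exact: F_psi_sum | exact: F_psiP].
noncomm.
Qed.

Variable T : {rmorphism fps F -> fps F}.
Hypothesis T_spec : is_T1_action iF iFe iK s pi Psi E T.

(** With [p] and [q] the expansions of the swept [f i] and [f i.+1], the translate [u] of
    [psi i] satisfies [u eps = q + b i / p], that is [u p eps = q p + b i], while
    [p q = eps psi_i q - b i.+1]. Comparing the coefficients of [eps^2] eliminates the
    unknown second order terms of [p] and [q] and leaves a commutator of their linear
    terms; at this order the two [b] differ by [gamma i]. *)
Lemma T_psi_coef i : (0 < i < l)%N ->
  fps_coef (T (fpsC (psi i))) 0 = psi i /\
  fps_coef (T (fpsC (psi i))) 1 = psi i * S i - S i.+1 * psi i + gamma i.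
Proof.
move=> il; have [_ _ _ _ T_psi] := T_spec.
have [|q [qE q0 q1]] := @expands_swept_f i.+1; first lia.
have [|p [pE pq p0 p1]] := expands_swept_f_step _ qE q0; first lia.
have p0_unit : fps_coef p 0 \is a GRing.unit by rewrite p0 unitr1.
have [p' [p'E _ _ p'p]] := expandsV Fe_skew pE p0_unit.
set u := T (fpsC (psi i)).
have uE : u * eps = q + b i * p'.
  apply: (@expands_fun F Fe E (Psi (T1_K s pi (f i.+1)))).
    by apply: (expandsMX Fe_skew iFe_inj E_spec); apply: T_psi; lia.
  rewrite T1_K_f // !rmorphD !rmorphM !skew_rmorphV //.
  apply: expandsD => //; apply: expandsM => //.
  by apply: expands_swept_alpha; lia.
have up : u * p * eps = q * p + b i.
  by rewrite -mulrA fps_commX mulrA uE mulrDl -mulrA p'p mulr1.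
have [b0 b1 b2] := swept_alpha_series_coef i.
have [c0 c1 c2] := swept_alpha_series_coef i.+1.
have bc : fps_coef (b i) 2 = gamma i + fps_coef (b i.+1) 2.
  rewrite b2 c2 big_ltn; last lia.
  by rewrite F_gammaE // addrCA.
have u0 : fps_coef u 0 = psi i.
  have := congr1 (fun r => fps_coef r 1) up.
  rewrite fps_coefMX fps_coefD fps_coefM0 fps_coefM1 p0 q0 p1 b1 F_psiE //.
  move=> /=; rewrite mulr1 mul1r mulr1 => ->.
  noncomm.
have p1S : fps_coef p 1 = - S i.
  have [|r [rE _ <-]] := @expands_swept_f i; first lia.
  by rewrite (expands_fun rE pE).
split=> //.
(* At order two, [p q] and [q p] differ only in the products of the linear terms, so
   [p_2] read off from the former can be eliminated from the latter. *)
have p2 : fps_coef p 2 =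
    phi i.+1 * fps_coef q 1 - fps_coef (b i.+1) 2 - fps_coef q 2
    - (phi i.+1 - t - fps_coef q 1) * fps_coef q 1.
  have := congr1 (fun r => fps_coef r 2) pq.
  rewrite -fps_commX -(mulrA _ _ q) -fps_commX mulrA fps_coefD fps_coefMX fps_coefN.
  rewrite fps_coefM1 !fps_coefC fps_coefM2 p0 q0 p1 /= mul1r mulr1 mul0r addr0 => <-.
  noncomm.
have := congr1 (fun r => fps_coef r 2) up.
rewrite fps_coefMX fps_coefD fps_coefM1 fps_coefM2 p0 q0 u0 bc p2 mulr1 mul1r.
move/(canRL (addKr _)) ->.
have -> : S i.+1 = - fps_coef q 1 by rewrite q1 opprK.
rewrite {1}p1S p1 -(F_psiE iF il).
have tq := F_t_central F_quotient (fps_coef q 1).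
by rewrite !mulrBr -tq; move: (fps_coef (b i.+1) 2) => c; noncomm.
Qed.

(** The translation is the identity modulo [eps], because it is on generators. *)
Lemma T_fpsC_eval0 x : fps_coef (T (fpsC x)) 0 = x.
Proof.
have [_ [T_scalar _ T_h] T_t T_beta _] := T_spec.
pose tau := fps_eval0 (F := F) \o T \o @fpsC F : {rmorphism F -> F}.
rewrite -[LHS]/(tau x); apply: (F_ind n_gt0 F_quotient (P := fun x => tau x = x)) => {x}.
- by move=> c; rewrite /tau /= T_scalar fpsCK.
- by move=> i /T_psi_coef [].
- by move=> i il; rewrite /tau /= T_beta ?fpsCK.
- by rewrite /tau /= T_t /fps_eval0 fps_coefD fps_coefX fps_coefC addr0.
- by rewrite /tau /= T_h fpsCK.
- by move=> x y tx ty; rewrite rmorphD tx ty.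
- by move=> x y tx ty; rewrite rmorphM tx ty.
- by move=> x ux tx; rewrite rmorphV // tx.
Qed.

Local Notation delta := (eps_derivation T).

(** A first order coefficient of a morphism congruent to the identity: this makes the
    Leibniz rule below immediate. *)
Lemma deltaE x : delta x = fps_coef (T (fpsC x)) 1.
Proof.
rewrite /eps_derivation /fps_eval0 /fps_div_eps [LHS]fps_coefD.
by rewrite fps_coefN fps_coefC subr0.
Qed.

Lemma deltaD x y : delta (x + y) = delta x + delta y.
Proof. by rewrite !deltaE !rmorphD. Qed.

Lemma deltaMz x m : delta (x *~ m) = delta x *~ m.
Proof. by rewrite !deltaE !rmorphMz fps_coefMz. Qed.

Lemma deltaM x y : delta (x * y) = delta x * y + x * delta y.
Proof. by rewrite !deltaE !rmorphM fps_coefM1 !T_fpsC_eval0 addrC. Qed.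

Lemma delta_fixed x : T (fpsC x) = fpsC x -> delta x = 0.
Proof. by rewrite deltaE => ->; rewrite fps_coefC. Qed.

Lemma delta0 : delta 0 = 0.
Proof. by apply: delta_fixed; rewrite !rmorph0. Qed.

Lemma deltaN x : delta (- x) = - delta x.
Proof. by apply/eqP; rewrite -addr_eq0 -deltaD addNr delta0. Qed.

Lemma delta_sum (I : Type) (r : seq I) (g : I -> F) :
  delta (\sum_(i <- r) g i) = \sum_(i <- r) delta (g i).
Proof. exact: (big_morph _ deltaD delta0). Qed.

Lemma delta_scalar c : delta (F_scalar iF c) = 0.
Proof. by have [_ [T_scalar _ _] _ _ _] := T_spec; apply: delta_fixed. Qed.

Lemma delta_h : delta (F_h iF) = 0.
Proof. by have [_ [_ _ T_h] _ _ _] := T_spec; apply: delta_fixed. Qed.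

Lemma delta_beta i : (i <= l)%N -> delta (beta i) = 0.
Proof. by move=> il; have [_ _ _ T_beta _] := T_spec; apply: delta_fixed; apply: T_beta. Qed.

Lemma delta_t : delta t = 1.
Proof.
have [_ _ T_t _ _] := T_spec.
by rewrite deltaE T_t fps_coefD fps_coefC fps_coefX add0r.
Qed.

Lemma delta_gamma i : delta (gamma i) = 0.
Proof.
rewrite /F_gamma; have : (i %% l < l)%N by rewrite ltn_mod.
case: (i %% l)%N => [|j] jl; last exact: delta_beta.
by rewrite deltaD !delta_beta ?addr0.
Qed.

(** For [psi 0] there is no direct expansion, but the sum of all the right-hand sides is
    [1] by [sum_mul_odd_sum], which is also the derivative of the total sum [t]. *)
Lemma delta_psi i : delta (psi i) = psi i * S i - S i.+1 * psi i + gamma i.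
Proof.
pose G j := psi j * S j - S j.+1 * psi j + gamma j.
have GP j : G (j + l)%N = G j.
  have SP := @odd_sum_periodic n F psi (@F_psiP _ _ _ iF).
  by rewrite /G -addSn !SP F_psiP F_gammaP.
have deltaG j : (0 < j < l)%N -> delta (psi j) = G j.
  by move=> jl; rewrite deltaE; case: (T_psi_coef jl).
rewrite -[RHS]/(G i).
have imod : i = i %% l %[mod l] by rewrite modn_mod.
rewrite (periodic_modn GP imod) (periodic_modn (@F_psiP _ _ _ iF) imod).
have : (i %% l < l)%N by rewrite ltn_mod.
case: (i %% l)%N => {i imod} [_|i il]; last exact: deltaG.
have G_sum : \sum_(0 <= j < l) G j = delta t.
  rewrite big_split sumrB /= sum_mul_odd_sum; last exact: F_psiP.
  by rewrite subrr add0r F_gamma_sum delta_t.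
have := congr1 delta (F_psi_sum n_gt0 iF); rewrite -G_sum delta_sum.
rewrite big_ltn // [RHS]big_ltn // (eq_big_nat _ _ deltaG).
exact: addIr.
Qed.

End Translation.

Section Reflection.
Variable i : nat.
Hypothesis i_lt : (i < l)%N.
Variable r : {rmorphism fps F -> fps F}.
Hypothesis r_spec : is_r_action iF iFe iK s Psi E i r.

Let l_ge3 : (3 <= l)%N. Proof. by rewrite /ell; lia. Qed.

Definition reduced_r : {rmorphism F -> F} := fps_eval0 (F := F) \o r \o @fpsC F.

Lemma reduced_t : reduced_r t = t.
Proof. by have [_ [_ _ _ r_t] _ _ _] := r_spec; rewrite /= r_t fpsCK. Qed.

Lemma reduced_gamma j : reduced_r (gamma j) = gamma j - gamma i *~ cartan l i j.
Proof.
have [_ _ r_gamma _ _] := r_spec.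
have jl : j = j %% l %[mod l] by rewrite modn_mod.
rewrite (periodic_modn (@F_gammaP _ _ _ iF) jl).
rewrite (periodic_modn (cartan_periodic l i) jl) /= r_gamma ?fpsCK //.
by have := ltn_pmod j (isT : 0 < l)%N; lia.
Qed.

Hypothesis psi_unit : psi i \is a GRing.unit.

Lemma expands_r_psi j : (0 < j < l)%N ->
  expands_Psi (r_K s i (f j.+1)) (r (fpsC (psi j)) * eps).
Proof.
move=> jl; have [_ _ _ _ r_psi] := r_spec.
by apply: (expandsMX Fe_skew iFe_inj E_spec); apply: r_psi; lia.
Qed.

(** Numerator and denominator of the correction are single terms here, so that the
    expansion of [r i] stops at the constant term. *)
Lemma r_psi_eval0_gt0 j : (0 < i)%N -> (0 < j < l)%N ->
  fps_coef (r (fpsC (psi j))) 0 = psi j + (gamma i / psi i) *~ umat l i j.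
Proof.
move=> i0 jl.
have il : (0 < i < l)%N by rewrite i0.
have numE : expands_Psi (alpha i.+1) (eps * fpsC (gamma i) * eps).
  rewrite -mulrA fps_commX mulrA F_gammaE //; apply: expands_alpha; lia.
have denE : expands_Psi (f i.+1) (fpsC (psi i) * eps).
  by rewrite fps_commX F_psiE //; apply: expands_f; lia.
have den_unit : fps_coef (fpsC (psi i)) 0 \is a GRing.unit by rewrite fps_coefC.
have [q [qE psi_q _]] := expands_quot Fe_skew iFe_inj E_spec numE denE den_unit.
have q0 : fps_coef q 0 = (psi i)^-1.
  by rewrite (fps_inv_coef0 psi_q) // fps_coefC.
have u_eq : r (fpsC (psi j)) = fpsC (psi j) + (fpsC (gamma i) * q) *~ umat l i j.
  apply: fps_mulIX; apply: expands_fun (expands_r_psi jl) _.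
  rewrite r_K_f // rmorphD rmorphMz rmorphM skew_rmorphV // mulrDl mulrzAl !fps_commX mulrA.
  apply: expandsD; last exact: expandsMz.
  by rewrite F_psiE //; apply: expands_f; lia.
by rewrite u_eq fps_coefD fps_coefMz fps_coefM0 !fps_coefC q0.
Qed.

(** Here numerator [alpha 0 + alpha 1] and denominator [f 1 + alpha 0 / f 0] both vanish
    at [eps = 0], to orders two and one, with leading terms [gamma 0] and [psi 0]. For
    [psi (l - 1)] the terms of order zero of the two fractions in [r_K0_fl] cancel. *)
Lemma r_psi_eval0_eq0 j : i = 0%N -> (0 < j < l)%N ->
  fps_coef (r (fpsC (psi j))) 0 = psi j + (gamma i / psi i) *~ umat l i j.
Proof.
move=> i0 jl.
have -> : umat l i j = if j == 1%N then 1 else if j == l.-1 then -1 else 0.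
  by rewrite i0 -[in LHS](add0n j) umatE //; case/andP: jl.
have [x [xE x0 x1]] := expands_f01 (isT : 0 < 2)%N.
have [y [yE y0 y1]] := expands_f01 (isT : 1 < 2)%N.
have [a [b [aE bE ab [a0 a1 b0 b1]]]] := expands_alpha01.
have [|x' [x'E _ xx' _]] := expandsV Fe_skew xE; first by rewrite x0 unitr1.
have [x'0 x'1] := fps_inv_coef xx' x0.
have [z [zE z0 z1]] : exists z, [/\ expands_Psi (f 1%N + alpha 0%N / f 0%N) z,
    fps_coef z 0 = 0 & fps_coef z 1 = psi i].
  exists (y + a * x'); split.
  - by rewrite rmorphD rmorphM skew_rmorphV //; apply/expandsD/expandsM.
  - by rewrite fps_coefD fps_coefM0 y0 a0 x'0 mulr1 subrr.
  - rewrite fps_coefD fps_coefM1 y1 a0 a1 x'0 x'1 x1 i0 F_psi0; noncomm.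
have [w [wE w0 w1]] : exists w,
    [/\ expands_Psi ((alpha 1%N + alpha 0%N) / (f 1%N + alpha 0%N / f 0%N)) w,
    fps_coef w 0 = 0 & fps_coef w 1 = gamma i / psi i].
  have numE : expands_Psi (alpha 1%N + alpha 0%N) (eps * fpsC (gamma i) * eps).
    by rewrite i0 -ab rmorphD; apply: expandsD.
  have denE : expands_Psi (f 1%N + alpha 0%N / f 0%N) (fps_div_eps z * eps).
    by rewrite fps_commX fps_div_epsK.
  have den0 : fps_coef (fps_div_eps z) 0 = psi i := z1.
  have den_unit : fps_coef (fps_div_eps z) 0 \is a GRing.unit by rewrite den0.
  have [q [qE zq _]] := expands_quot Fe_skew iFe_inj E_spec numE denE den_unit.
  have q0 : fps_coef q 0 = (psi i)^-1.
    by rewrite (fps_inv_coef0 zq) // den0.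
  exists (eps * fpsC (gamma i) * q); split.
  - by rewrite rmorphM skew_rmorphV.
  - by rewrite -mulrA fps_coefXM.
  - by rewrite -mulrA fps_coefXM fps_coefM0 fps_coefC q0.
have uE p : expands_Psi (r_K s 0 (f j.+1)) p ->
    fps_coef (r (fpsC (psi j))) 0 = fps_coef p 1.
  have := expands_r_psi jl; rewrite [in r_K _ _ _]i0 => rE pE.
  by rewrite -(expands_fun rE pE) fps_coefMX.
have [g [gE g1]] : exists g, expands_Psi (f j.+1) g /\ fps_coef g 1 = psi j.
  exists (eps * fpsC (psi j)); rewrite fps_coefXM fps_coefC; split=> //.
  by rewrite F_psiE //; apply: expands_f; lia.
have [j1|j1] := eqVneq j 1%N.
  rewrite (uE (g + w)); first by rewrite fps_coefD g1 w1.
  rewrite j1 in gE *; rewrite r_K0_f2 // rmorphD; exact: expandsD.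
have [jl1|jl1] := eqVneq j l.-1.
  have [v [vE v0 v1]] : exists v, [/\ expands_Psi
      (f 0%N - (alpha 1%N + alpha 0%N) / (f 1%N + alpha 0%N / f 0%N)) v,
      fps_coef v 0 = 1 & fps_coef v 1 = phi 0%N - gamma i / psi i].
    exists (x - w); split; first by rewrite rmorphB; apply: expandsB.
      by rewrite fps_coefD fps_coefN x0 w0 subr0.
    by rewrite fps_coefD fps_coefN x1 w1.
  have [|v' [v'E _ vv' _]] := expandsV Fe_skew vE; first by rewrite v0 unitr1.
  have [v'0 v'1] := fps_inv_coef vv' v0.
  rewrite (uE (g - a * x' - b * v')).
    rewrite 2!fps_coefD !fps_coefN !fps_coefM1 g1 a0 a1 b0 b1 x'0 x'1 v'0 v'1.
    rewrite x1 v1 mulrN1z; noncomm.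
  rewrite (_ : j.+1 = l) in gE *; last lia.
  rewrite r_K0_fl // 2!rmorphB [Psi (_ / f 0%N)]rmorphM [Psi (_ / (_ - _))]rmorphM.
  rewrite !skew_rmorphV //.
  by apply: expandsB; [apply: expandsB => //|]; apply: expandsM.
rewrite (uE g); first by rewrite g1 addr0.
by rewrite r_K0_f //; lia.
Qed.

Lemma reduced_psi j : reduced_r (psi j) = psi j + (gamma i / psi i) *~ umat l i j.
Proof.
have jl : j = j %% l %[mod l] by rewrite modn_mod.
rewrite (periodic_modn (@F_psiP _ _ _ iF) jl) (periodic_modn (umat_periodic l i) jl).
have : (j %% l < l)%N by rewrite ltn_mod.
have psi_gt0 k : (0 < k < l)%N ->
    reduced_r (psi k) = psi k + (gamma i / psi i) *~ umat l i k.
  move=> kl; have [i0|i0] := posnP i; first exact: r_psi_eval0_eq0.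
  exact: r_psi_eval0_gt0.
case: (j %% l)%N => {j jl} [_|j jl]; last exact: psi_gt0.
(* The total sum [t] is fixed, and the corrections of the [psi j] add up to zero. *)
have corr_sum : \sum_(0 <= k < l) (gamma i / psi i) *~ umat l i k = 0.
  rewrite -[RHS](sum_umat l_ge3 (gamma i / psi i) i).
  rewrite [RHS](periodic_sum (g := fun k => (gamma i / psi i) *~ umat l i k)) // => k.
  by rewrite umat_periodic.
have rho_sum : \sum_(0 <= k < l) reduced_r (psi k) =
    \sum_(0 <= k < l) (psi k + (gamma i / psi i) *~ umat l i k).
  by rewrite -[LHS]rmorph_sum F_psi_sum // [LHS]reduced_t big_split /= corr_sum addr0 F_psi_sum.
move: rho_sum; rewrite [LHS]big_ltn // [RHS]big_ltn // (eq_big_nat _ _ psi_gt0).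
exact: addIr.
Qed.

End Reflection.

(** * Commutation of the reflections with the derivation *)

Section Commutation.
Variables (pi : {rmorphism K -> K}) (T : {rmorphism fps F -> fps F}).
Hypothesis pi_spec : is_rotation_K iK pi.
Hypothesis T_spec : is_T1_action iF iFe iK s pi Psi E T.
Variable r : 'I_l -> {rmorphism fps F -> fps F}.
Hypothesis r_spec : forall i : 'I_l, is_r_action iF iFe iK s Psi E i (r i).
Local Notation delta := (eps_derivation T).

Let l_ge3 : (3 <= l)%N. Proof. by rewrite /ell; lia. Qed.
Let dpsi := delta_psi pi_spec T_spec.

(** If [psi i] vanished, so would its derivative [gamma i]; each reflection passes the
    vanishing on to the next [gamma], whereas the sum of all of them is [1]. *)
Lemma psi_unit i : psi i \is a GRing.unit.
Proof.
have F_skew : is_skew_field F by case: F_quotient.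
apply: F_skew; apply/eqP => psi0.
have gamma_i : gamma i = 0.
  have := dpsi i; rewrite psi0 mul0r mulr0 subrr add0r => <-.
  exact: delta0.
have gamma0 m : gamma (i + m)%N = 0.
  elim: m => [|m IH]; first by rewrite addn0.
  have kl : ((i + m.+1) %% l < l)%N by rewrite ltn_mod.
  have := reduced_gamma kl (r_spec (Ordinal kl)) (i + m).
  rewrite IH rmorph0 sub0r /=.
  have kE : (i + m)%N = ((i + m.+1) %% l) + l.-1 %[mod l].
    by rewrite modnDml -addnA addSnnS prednK // addnA modnDr.
  rewrite (periodic_modn (cartan_periodic l _) kE) cartanE; try lia.
  rewrite ifN ?ifT ?mulrN1z ?opprK => [g0||]; try lia.
  by rewrite [RHS]g0; apply: (periodic_modn (@F_gammaP _ _ _ iF)); rewrite modn_mod.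
have := F_gamma_sum iF; rewrite -(periodic_sum (@F_gammaP _ _ _ iF) i).
by rewrite big1 => [/eqP|k _]; rewrite ?gamma0 // eq_sym oner_eq0.
Qed.

(** The elements on which the two sides agree are closed under the field operations,
    because both sides are derivations along the morphism [rho]. Apart from the [psi j],
    a generator and its image under [rho] have the same derivative, [0] or [1]. *)
Lemma reduced_delta (i : 'I_l) x : reduction (r i) (delta x) = delta (reduction (r i) x).
Proof.
have ri := r_spec i; have [_ [r_scalar _ r_h r_t] _ r_beta0 _] := ri.
pose rho := reduced_r (r i).
have rhoE y : fps_coef (r i (fpsC y)) 0 = rho y by [].
rewrite -[LHS]/(rho (delta x)) -[reduction _ _]/(rho x).
have dD := deltaD T.
have dM := deltaM pi_spec T_spec.
have dgamma j := delta_gamma T_spec j.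
have d0 := delta0 T; have dN := deltaN T.
have const_gamma j : delta (rho (gamma j)) = 0.
  by rewrite (reduced_gamma (ltn_ord i) ri) dD dgamma dN deltaMz dgamma mul0rz subr0.
have const_beta j : (j <= l)%N -> delta (rho (beta j)) = 0.
  have const_beta0 : delta (rho (beta 0%N)) = 0.
    rewrite -rhoE r_beta0 fps_coefC /=.
    have dbeta k : (k <= l)%N -> delta (beta k) = 0 by move=> kl; exact: (delta_beta T_spec kl).
    case: ifP => _; first by rewrite dN dbeta ?oppr0.
    by case: ifP => _; rewrite ?dD !dbeta ?addr0.
  case: j => [//|[|j]] jl.
    have -> : beta 1%N = gamma 0%N - beta 0%N by rewrite F_gamma0 addrC addKr.
    by rewrite rmorphB dD dN const_gamma const_beta0 subr0.
  by rewrite -F_gammaE ?const_gamma //; lia.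
apply: (F_ind n_gt0 F_quotient (P := fun x => rho (delta x) = delta (rho x))) => {x}.
- move=> c; have -> : rho (F_scalar iF c) = F_scalar iF c by rewrite -rhoE r_scalar fps_coefC.
  by rewrite (delta_scalar T_spec) rmorph0.
- move=> j _; apply: (rho_delta_psi n_gt0 (@F_psiP _ _ _ iF)
    (F_gamma_central F_quotient) (F_psi_sum n_gt0 iF) dD dM dgamma dpsi (ltn_ord i)
    (psi_unit i) (reduced_t ri) (w := gamma i / psi i)).
  + by rewrite divrK ?psi_unit.
  + exact: (reduced_psi (ltn_ord i) ri (psi_unit i)).
  + exact: (reduced_gamma (ltn_ord i) ri).
- by move=> j jl; rewrite const_beta // (delta_beta T_spec) // rmorph0.
- have -> : rho t = t by apply: reduced_t ri.
  by rewrite (delta_t T_spec) rmorph1.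
- have -> : rho (F_h iF) = F_h iF by rewrite -rhoE r_h fps_coefC.
  by rewrite (delta_h T_spec) rmorph0.
- by move=> x y xP yP; rewrite [rho (x + y)]rmorphD !dD rmorphD xP yP.
- by move=> x y xP yP; rewrite dM rmorphD !rmorphM dM xP yP.
- move=> x x_unit xP; have rx_unit : rho x \is a GRing.unit by apply: rmorph_unit.
  apply: (mulrI rx_unit); apply: (addrI (rho (delta x) * rho x^-1)).
  rewrite [in RHS]xP -dM -!rmorphM -rmorphD -dM divrr // rmorph1.
  have d1 : delta 1 = 0 by apply: delta_fixed; rewrite !rmorph1.
  by rewrite d1 rmorph0.
Qed.

End Commutation.

End Degeneration.

Theorem theorem3p4 (R : realType) (n : nat) (n_ge1 : (1 <= n)%N)
  (K : unitRingType) (iK : {rmorphism Kalg R n -> K})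
  (K_quotient : is_quotient_skew_field iK)
  (s : 'I_(ell n).+1 -> {rmorphism K -> K})
  (s_spec : forall i, is_reflection_K iK i (s i))
  (pi : {rmorphism K -> K}) (pi_spec : is_rotation_K iK pi)
  (F : unitRingType) (iF : {rmorphism Falg R n -> F})
  (F_quotient : is_quotient_skew_field iF)
  (Fe : unitRingType) (iFe : {rmorphism {poly F} -> Fe})
  (Fe_quotient : is_quotient_skew_field iFe)
  (Psi : {rmorphism K -> Fe}) (Psi_spec : is_Psi iF iFe iK Psi)
  (E : {rmorphism Fe -> laurent F}) (E_spec : is_expansion iFe E)
  (T1 : {rmorphism fps F -> fps F})
  (T1_spec : is_T1_action iF iFe iK s pi Psi E T1)
  (r : 'I_(ell n) -> {rmorphism fps F -> fps F})
  (r_spec : forall i : 'I_(ell n), is_r_action iF iFe iK s Psi E i (r i)) :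
  (forall i : 'I_(ell n),
     eps_derivation T1 (F_psi iF i) =
       F_psi iF i * (\sum_(1 <= k < n.+1) F_psi iF (i + 2 * k - 1)%N)
       - (\sum_(1 <= k < n.+1) F_psi iF (i + 2 * k)%N) * F_psi iF i
       + F_gamma iF i) /\
  (forall (i : 'I_(ell n)) (x : F),
     reduction (r i) (eps_derivation T1 x) =
     eps_derivation T1 (reduction (r i) x)).
Proof.
split=> [i|i x].
  rewrite -odd_sumS.
  exact: (delta_psi n_ge1 K_quotient s_spec F_quotient Fe_quotient Psi_spec E_spec
    pi_spec T1_spec).
exact: (reduced_delta n_ge1 K_quotient s_spec F_quotient Fe_quotient Psi_spec E_spec
  pi_spec T1_spec r_spec).
Qed.
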